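(* Let $q\in(0,\infty)$ and $\overline q=\max\{4/p,1\}\,q$. Write $L^q_E:=L^q\big(\Omega;(E_{\mathcal{D},0},\|\Pi_{\mathcal{D}}\cdot\|_{L^2(\mathcal{O})})\big)$. The full-step solution operator $\mathscr{S}_{\mathrm{CN}}$ satisfies: (i) (boundedness) $\mathscr{S}_{\mathrm{CN}}$ is bounded, i.e. $\mathscr{S}_{\mathrm{CN}}:L^q_E\times L^q(\Omega)\to L^q_E$; (ii) (continuity with respect to initial velocity) for any random update $\Delta W\in L^q(\Omega)$, the map $\mathscr{S}_{\mathrm{CN}}[\cdot,\Delta W]:L^q_E\to L^q_E$ is Lipschitz-continuous; (iii) (continuity with respect to random update) for any $v^{\mathrm{in}}_{\mathcal{D}}\in L^{\overline q}_E$, the map $\mathscr{S}_{\mathrm{CN}}[v^{\mathrm{in}}_{\mathcal{D}},\cdot]:L^{\overline q}(\Omega)\to L^q_E$ is continuous.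
   Context: Setting. $(\Omega,\mathcal{F},\mathbb{P})$ is a probability space. $\mathcal{O}\subset\mathbb{R}^d$ is a bounded polygonal domain. $p\in(1,\infty)$, $p'=p/(p-1)$, $p\wedge p'=\min(p,p')$, $\kappa\ge0$, $\tau>0$ is a fixed time step. For $A\in\mathbb{R}^{d\times d}$ (with Euclidean norm $|A|$), $S(A)=(\kappa+|A|^2)^{(p-2)/2}A$ (with $S(0)=0$). $\mathbb{L}^2(\mathcal{O})$ is the space of $L^2$ vector fields $\mathcal{O}\to\mathbb{R}^d$; $(\cdot,\cdot)$ is the $L^2(\mathcal{O})$ pairing $\int_{\mathcal{O}}$ of (scalar, vector or matrix) functions. $\mathbb{W}^{k,\infty}_{\mathrm{div}}(\mathcal{O})$ is the $W^{k,\infty}$-closure of smooth vector fields on $\mathcal{O}$ with zero divergence. The data are deterministic and time-independent: $g\in\mathbb{W}^{2,\infty}_{\mathrm{div}}(\mathcal{O})$, $\sigma\in\mathbb{W}^{1,\infty}_{\mathrm{div}}(\mathcal{O})$. $\varepsilon g=\tfrac12(\nabla g+(\nabla g)^T)$ and $(\sigma\cdot\nabla)g=\sum_j\sigma_j\partial_jg$. Gradient Discretisation (GD). $\mathcal{D}=(X_{\mathcal{D},0},Y_{\mathcal{D}},\nabla_{\mathcal{D}},\varepsilon_{\mathcal{D}},\chi_{\mathcal{D}},\mathrm{div}_{\mathcal{D}},\Pi_{\mathcal{D}})$ where $X_{\mathcal{D},0},Y_{\mathcal{D}}$ are finite-dimensional real vector spaces; $\nabla_{\mathcal{D}},\varepsilon_{\mathcal{D}}:X_{\mathcal{D},0}\to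 L^p(\mathcal{O})^{d\times d}$, $\mathrm{div}_{\mathcal{D}}:X_{\mathcal{D},0}\to L^p(\mathcal{O})$, $\Pi_{\mathcal{D}}:X_{\mathcal{D},0}\to L^2(\mathcal{O})^d$, $\chi_{\mathcal{D}}:Y_{\mathcal{D}}\to L^{p\wedge p'}(\mathcal{O})$ are linear; $\nabla_{\mathcal{D}},\varepsilon_{\mathcal{D}},\mathrm{div}_{\mathcal{D}},\Pi_{\mathcal{D}}$ moreover take values in $L^p\cap L^{p'}$, so that all pairings and constants below make sense. $\|\varepsilon_{\mathcal{D}}\cdot\|_{L^p(\mathcal{O})}$ is a norm on $X_{\mathcal{D},0}$. With $Y_{\mathcal{D},0}=\{q\in Y_{\mathcal{D}}:\int_{\mathcal{O}}\chi_{\mathcal{D}}q\,dx=0\}$, $\|\chi_{\mathcal{D}}\cdot\|_{L^{p\wedge p'}(\mathcal{O})}$ is a norm on $Y_{\mathcal{D},0}$. $E_{\mathcal{D},0}=\{v\in X_{\mathcal{D},0}:(\chi_{\mathcal{D}}q,\mathrm{div}_{\mathcal{D}}v)=0\ \forall q\in Y_{\mathcal{D},0}\}$, and $\Pi_{\mathcal{D}}$ is one-to-one on $E_{\mathcal{D},0}$. The $L^2$-projection $\mathcal{K}_{\mathcal{D}}:\mathbb{L}^2(\mathcal{O})\to E_{\mathcal{D},0}$ is defined by $(u-\Pi_{\mathcal{D}}\mathcal{K}_{\mathcal{D}}u,\Pi_{\mathcal{D}}\xi)=0$ for all $\xi\in E_{\mathcal{D},0}$. For $r\in\{p,p'\}$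 put $C_{\mathcal{D}}(r)=\sup_{v\in X_{\mathcal{D},0}\setminus\{0\}}\frac{\|\Pi_{\mathcal{D}}v\|_{L^r}+\|\mathrm{div}_{\mathcal{D}}v\|_{L^r}+\|\nabla_{\mathcal{D}}v\|_{L^r}}{\|\varepsilon_{\mathcal{D}}v\|_{L^r}}$, $C^{\mathrm{Sob}}_{\mathcal{D}}(r)=\sup_{z\in W^{1,r}(\mathcal{O})^d\setminus\{0\}}\frac{\|\varepsilon_{\mathcal{D}}\mathcal{K}_{\mathcal{D}}z\|_{L^r}}{\|z\|_{W^{1,r}}}$, and $\beta_{\mathcal{D}}(p)=\inf_{q\in Y_{\mathcal{D},0}\setminus\{0\}}\sup_{v\in X_{\mathcal{D},0}\setminus\{0\}}\frac{(\chi_{\mathcal{D}}q,\mathrm{div}_{\mathcal{D}}v)}{\|\chi_{\mathcal{D}}q\|_{L^{p\wedge p'}}(\|\varepsilon_{\mathcal{D}}v\|_{L^p}+\|\varepsilon_{\mathcal{D}}v\|_{L^{p'}})}$. Standing assumption: $\mathcal{D}$ is $\Gamma$-stable, i.e. for some $\Gamma\in[1,\infty)$: $C_{\mathcal{D}}(p)+C_{\mathcal{D}}(p')\le\Gamma$, $\beta_{\mathcal{D}}(p)\ge\Gamma^{-1}$, $C^{\mathrm{Sob}}_{\mathcal{D}}(p)+C^{\mathrm{Sob}}_{\mathcal{D}}(p')\le\Gamma$. Discrete noise form: $B^\sigma_{\mathcal{D}}(v,\xi)=\tfrac12(\sigma^T\nabla_{\mathcal{D}}v,\Pi_{\mathcal{D}}\xi)-\tfrac12(\Pi_{\mathcal{D}}v,\sigma^T\nabla_{\mathcal{D}}\xi)$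 for $v,\xi\in X_{\mathcal{D},0}$, where $(\sigma^T\nabla_{\mathcal{D}}v)_i=\sum_j\sigma_j(\nabla_{\mathcal{D}}v)_{ji}$ is the discrete counterpart of $(\sigma\cdot\nabla)v$. Spaces. $L^q(\Omega;(E_{\mathcal{D},0},\|\Pi_{\mathcal{D}}\cdot\|_{L^2(\mathcal{O})}))$ is the set of random variables $u:\Omega\to E_{\mathcal{D},0}$ with $\mathbb{E}[\|\Pi_{\mathcal{D}}u\|_{L^2(\mathcal{O})}^q]<\infty$, with the (quasi-)norm $\mathbb{E}[\|\Pi_{\mathcal{D}}u\|_{L^2(\mathcal{O})}^q]^{1/q}$; $L^q(\Omega)$ is the space of real random variables with finite $q$-th moment. Full-step solution operator. $\mathscr{S}_{\mathrm{CN}}$ maps an input velocity $v^{\mathrm{in}}_{\mathcal{D}}$ (with values in $E_{\mathcal{D},0}$) and a random update $\Delta W$ (real-valued) to the unique solution $w=\mathscr{S}_{\mathrm{CN}}[v^{\mathrm{in}}_{\mathcal{D}},\Delta W]$ with values in $E_{\mathcal{D},0}$ such that, for all $\xi\in E_{\mathcal{D},0}$ and $\mathbb{P}$-a.s., $$(\Pi_{\mathcal{D}}w-\Pi_{\mathcal{D}}v^{\mathrm{in}}_{\mathcal{D}},\Pi_{\mathcal{D}}\xi)+\tau\Big(S\big(\varepsilon_{\mathcal{D}}\tfrac{w+v^{\mathrm{in}}_{\mathcal{D}}}2+\varepsilon g\big),\varepsilon_{\mathcal{D}}\xi\Big)=\Big[B^\sigma_{\mathcal{D}}\big(\tfrac{w+v^{\mathrm{in}}_{\mathcal{D}}}2,\xi\big)+((\sigma\cdot\nabla)g,\Pi_{\mathcal{D}}\xi)\Big]\Delta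 W.$$ *)

(* Defs.v *)
From HB Require Import structures.
From mathcomp Require Import all_boot all_order all_algebra.
From mathcomp Require Import lra.
From mathcomp Require Import all_classical all_reals all_analysis.
Set Implicit Arguments. Unset Strict Implicit. Unset Printing Implicit Defensive.
Import Order.TTheory GRing.Theory Num.Theory.
Import numFieldNormedType.Exports.
Local Open Scope classical_set_scope.
Local Open Scope ring_scope.
Definition borel_rV_display : measure_display.
Proof. exact: default_measure_display. Qed.

Section borel_rV.
Context {R : realType} {d : nat}.
Let G : set (set 'rV[R]_d) := open.

HB.instance Definition _ :=
  @isMeasurable.Build borel_rV_display 'rV[R]_d <<s G >>
    (@sigma_algebra0 _ setT G) (@sigma_algebraC _ G)
    (@sigma_algebra_bigcup _ setT G).

End borel_rV.

Lemma open_measurable_rV (R : realType) d (U : set 'rV[R]_d) :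
  open U -> measurable U.
Proof. exact: sub_sigma_algebra. Qed.

Lemma measurable_coord_rV (R : realType) d (i : 'I_d) :
  measurable_fun setT (fun x : 'rV[R]_d => x 0 i).
Proof.
apply: (measurability _ (measurable_realfun.RGenOInfty.measurableE R)) => _ [_ [x ->] <-].
rewrite setTI; apply: open_measurable_rV.
apply: open_comp; first by move=> y _; exact: coord_continuous.
exact: interval_open.
Qed.

Lemma measurable_fun_rV (R : realType) d dT (T : measurableType dT)
    (f : T -> 'rV[R]_d) :
  (forall i, measurable_fun setT (fun t => f t 0 i)) -> measurable_fun setT f.
Proof.
move=> mf; have mE : @measurable _ (matrix R 1 d) = <<s open >> by [].
apply: (measurability _ mE) => _ [U oU <-]; rewrite setTI.
pose B (c : 'rV[rat]_d * nat) := [set x : 'rV[R]_d |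
  forall i, ratr (c.1 0 i) - c.2.+1%:R^-1 < x 0 i < ratr (c.1 0 i) + c.2.+1%:R^-1].
have -> : U = \bigcup_(c in [set c | B c `<=` U]) B c.
  apply/seteqP; split => [x Ux|x [c cU]]; last exact: cU.
  have /nbhs_ballP[e /= e0 eU] : nbhs x U by exact: open_nbhs_nbhs.
  pose n := Num.truncn (2 / e).
  have n0 : 0 < (n.+1%:R : R)^-1 by rewrite invr_gt0.
  have ne : 2 * n.+1%:R^-1 < e.
    by rewrite ltr_pdivrMr// mulrC -ltr_pdivrMr//; exact: truncnS_gt.
  have q i : {q : rat | x 0 i - n.+1%:R^-1 < ratr q < x 0 i + n.+1%:R^-1}.
    apply: cid; have [|q qI] := @rat_in_itvoo R (x 0 i - n.+1%:R^-1) (x 0 i + n.+1%:R^-1).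
      by rewrite ltrBlDr -addrA ltrDl addr_gt0.
    by exists q; move: qI; rewrite in_itv.
  exists (\row_i sval (q i), n) => /= [y yB|i].
    apply: eU; split => // i j; rewrite (ord1 i) /ball/=.
    move: (yB j); rewrite !mxE; case: (q j) => r /= /andP[r1 r2] /andP[y1 y2].
    rewrite ltr_norml; move: (x 0 j) (y 0 j) (ratr r) (_^-1) r1 r2 y1 y2 ne.
    move=> a b c k r1 r2 y1 y2 ne; apply/andP; split; lra.
  rewrite /= mxE; case: (q i) => r /= /andP[]; move: (x 0 i) (ratr r) (_^-1).
  by move=> a b k r1 r2; apply/andP; split; lra.
rewrite preimage_bigcup bigcup_mkcond.
apply: countable_bigcupT_measurable => // c; case: ifP => // _.
have -> : f @^-1` B c = \bigcap_(i in [set: 'I_d])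
   ((fun t => f t 0 i) @^-1` `]ratr (c.1 0 i) - c.2.+1%:R^-1, ratr (c.1 0 i) + c.2.+1%:R^-1[).
  apply/seteqP; split => t /= H i; first by move=> _; rewrite /= in_itv/= H.
  by move: (H i I); rewrite /= in_itv.
apply: fin_bigcap_measurable => // i _.
by rewrite -[X in measurable X]setTI; apply: mf.
Qed.

Section lebesgue_rV.
Context {R : realType}.

Definition cons_rV n (z : measurableTypeR R * 'rV[R]_n) : 'rV[R]_n.+1 :=
  \row_i oapp (z.2 0) z.1 (unlift ord0 i).

Definition uncons_rV n (x : 'rV[R]_n.+1) : measurableTypeR R * 'rV[R]_n :=
  (x 0 ord0, \row_i x 0 (lift ord0 i)).

Lemma cons_rV0 n (z : measurableTypeR R * 'rV[R]_n) : cons_rV z 0 ord0 = z.1.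
Proof. by rewrite mxE unlift_none. Qed.

Lemma cons_rVS n (z : measurableTypeR R * 'rV[R]_n) i : cons_rV z 0 (lift ord0 i) = z.2 0 i.
Proof. by rewrite mxE liftK. Qed.

Lemma cons_rVK n : cancel (@cons_rV n) (@uncons_rV n).
Proof.
move=> [x v]; rewrite /uncons_rV cons_rV0; congr pair.
by apply/rowP => i; rewrite mxE cons_rVS.
Qed.

Lemma measurable_cons_rV n : measurable_fun setT (@cons_rV n).
Proof.
apply: measurable_fun_rV => i; case: (unliftP ord0 i) => [j|] ->.
  rewrite (_ : (fun _ => _) = (fun x : 'rV[R]_n => x 0 j) \o snd); last first.
    by apply/funext => z; rewrite cons_rVS.
  by apply: measurableT_comp => //; exact: measurable_coord_rV.
rewrite (_ : (fun _ => _) = fst)//.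
by apply/funext => z; rewrite cons_rV0.
Qed.

Lemma measurable_uncons_rV n : measurable_fun setT (@uncons_rV n).
Proof.
apply: measurable_fun_pair; first exact: measurable_coord_rV.
apply: measurable_fun_rV => i.
rewrite (_ : (fun _ => _) = fun x : 'rV[R]_n.+1 => x 0 (lift ord0 i)).
  exact: measurable_coord_rV.
by apply/funext => x; rewrite mxE.
Qed.

Section step.
Variables (n : nat) (m : {sigma_finite_measure set 'rV[R]_n -> \bar R}).

Definition lebesgue_cons : set 'rV[R]_n.+1 -> \bar R :=
  pushforward (lebesgue_measure \x m)%E (@cons_rV n).


Let prod_m := (lebesgue_measure \x m)%E.

Let lebesgue_cons0 : lebesgue_cons set0 = 0%E.
Proof. by rewrite /lebesgue_cons /pushforward preimage_set0 measure0. Qed.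

Let lebesgue_cons_ge0 A : (0 <= lebesgue_cons A)%E.
Proof. by rewrite /lebesgue_cons /pushforward measure_ge0. Qed.

Let lebesgue_cons_sigma_additive : semi_sigma_additive lebesgue_cons.
Proof.
have mf := @measurable_cons_rV n.
exact: (@measure_semi_sigma_additive _ _ _
  (@measure_function_pushforward__canonical__measure_function_Measure
    _ _ _ _ _ prod_m (@cons_rV n) mf)).
Qed.

HB.instance Definition _ := isMeasure.Build _ _ _ lebesgue_cons
  lebesgue_cons0 lebesgue_cons_ge0 lebesgue_cons_sigma_additive.

Let lebesgue_cons_sigma_finite : sigma_finite setT lebesgue_cons.
Proof.
have /sigma_finiteP[F [TF ndF Foo]] := sigma_finiteT (@lebesgue_measure R).
have /sigma_finiteP[G [TG ndG Goo]] := sigma_finiteT m.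
have ES k : @cons_rV n @^-1` (@uncons_rV n @^-1` (F k `*` G k)) = F k `*` G k.
  by rewrite -comp_preimage (_ : _ \o _ = id)//; apply/funext/cons_rVK.
exists (fun k => @uncons_rV n @^-1` (F k `*` G k)).
  apply/seteqP; split => // x _.
  have [i _ Fi] : (\bigcup_k F k) (uncons_rV x).1 by rewrite -TF.
  have [j _ Gj] : (\bigcup_k G k) (uncons_rV x).2 by rewrite -TG.
  exists (maxn i j) => //; split.
    by apply: (subsetPset _ _ (ndF _ _ (leq_maxl i j))).
  by apply: (subsetPset _ _ (ndG _ _ (leq_maxr i j))).
move=> k; have [mF Fk] := Foo k; have [mG Gk] := Goo k; split.
  rewrite -[X in measurable X]setTI; apply: measurable_uncons_rV => //.
  exact: measurableX.
rewrite /lebesgue_cons /pushforward ES product_measure1E//.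
by rewrite lte_mul_pinfty// ge0_fin_numE.
Qed.

HB.instance Definition _ := Measure_isSigmaFinite.Build _ _ _ lebesgue_cons
  lebesgue_cons_sigma_finite.

End step.

Fixpoint lebesgue_rV n : {sigma_finite_measure set 'rV[R]_n -> \bar R} :=
  if n is k.+1 then lebesgue_cons (lebesgue_rV k) else dirac (0 : 'rV[R]_0).

Lemma lebesgue_rV_box n (A : 'I_n -> set (measurableTypeR R)) :
  (forall i, measurable (A i)) ->
  lebesgue_rV n [set x | forall i, A i (x 0 i)] =
  (\prod_(i < n) lebesgue_measure (A i))%E.
Proof.
elim: n A => [|n IH] A mA /=.
  rewrite big_ord0 diracE mem_set//; by case.
rewrite big_ord_recl /= -(IH (fun i => A (lift ord0 i))) => [|i//].
have mB : measurable [set x : 'rV[R]_n | forall i, A (lift ord0 i) (x 0 i)].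
  rewrite (_ : mkset _ = \bigcap_(i in [set: 'I_n])
    ((fun x : 'rV[R]_n => x 0 i) @^-1` A (lift ord0 i))).
    apply: fin_bigcap_measurable => // i _.
    rewrite -[X in measurable X]setTI.
    by apply: measurable_coord_rV; [exact: measurableT|exact: mA].
  by apply/seteqP; split => x /= H i; [move=> _|]; exact: H.
rewrite -product_measure1E// /lebesgue_cons /pushforward.
congr (_ _); apply/seteqP; split => [z /= H|z /= [z0 zS] i].
  split; first by have := H ord0; rewrite cons_rV0.
  by move=> i; have := H (lift ord0 i); rewrite cons_rVS.
by case: (unliftP ord0 i) => [j|] ->; rewrite ?cons_rV0 ?cons_rVS.
Qed.
End lebesgue_rV.
Arguments lebesgue_rV {R} n.

Section fields.
Context {R : realType} {m n : nat}.
Implicit Types A B : 'M[R]_(m, n).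

Definition mxdot A B : R := \sum_i \sum_j A i j * B i j.

(* Euclidean (Frobenius) norm; the canonical norm `|A| is the sup norm *)
Definition enorm A : R := Num.sqrt (mxdot A A).

End fields.

Section domain.
Context {R : realType} {d : nat}.

Definition convex_hull (V : seq 'rV[R]_d) : set 'rV[R]_d :=
  [set x | exists a : 'I_(size V) -> R,
    [/\ forall i, 0 <= a i, \sum_i a i = 1 & x = \sum_i a i *: V`_i]].

End domain.

Record polygonal_domain (R : realType) (d : nat) := PolygonalDomain {
  domain_set :> set 'rV[R]_d;
  domain_nonempty : domain_set !=set0;
  domain_open : open domain_set;
  domain_connected : connected domain_set;
  domain_bounded : bounded_set domain_set;
  domain_polygonal : exists s : seq (seq 'rV[R]_d),
    domain_set = interior (\bigcup_(V in [set` s]) convex_hull V) }.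

Section function_spaces.
Context {R : realType} {d : nat} (O : polygonal_domain R d).
Local Notation point := 'rV[R]_d.

Definition leb_on : {measure set point -> \bar R} :=
  mrestr (lebesgue_rV d) (open_measurable_rV (@domain_open R d O)).

Local Notation mu := leb_on.

Definition in_Lmx (r : R) m n (F : point -> 'M[R]_(m, n)) :=
  forall i j, (fun x => F x i j) \in Lfun mu r%:E.

Definition Lnm (r : R) (f : point -> R) : R := fine 'N[mu]_(r%:E)[EFin \o f]%E.

Definition Lnmx (r : R) m n (F : point -> 'M[R]_(m, n)) : R :=
  Lnm r (fun x => enorm (F x)).

Definition pair_fun (f g : point -> R) : R := \int[mu]_x (f x * g x).

Definition pair_mx m n (F G : point -> 'M[R]_(m, n)) : R :=
  \int[mu]_x mxdot (F x) (G x).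

Definition component (u : point -> 'rV[R]_d) (i : 'I_d) : point -> R :=
  fun x => u x 0 i.

Definition partial (i : 'I_d) (f : point -> R) : point -> R :=
  fun x => 'D_(delta_mx 0 i : point) f x.

Definition smooth_on (U : set point) (f : point -> R) :=
  forall (s : seq 'I_d) x, U x ->
    {for x, continuous (foldr partial f s)} /\
    forall i, derivable (foldr partial f s) x (delta_mx 0 i : point).

Definition test_function (phi : point -> R) :=
  smooth_on setT phi /\
  exists K : set point,
    [/\ compact K, K `<=` O & forall x, ~ K x -> phi x = 0].

Definition is_wpartial (i : 'I_d) (u v : point -> R) :=
  [/\ measurable_fun setT v,
      forall K : set point, compact K -> K `<=` O ->
        (lebesgue_rV d).-integrable K (EFin \o v) &
      forall phi, test_function phi ->
        pair_fun u (partial i phi) = - pair_fun v phi].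

(* a representative of the weak derivative, meaningful when one exists; it is
   unique up to a null set *)
Definition wpartial (i : 'I_d) (u : point -> R) : point -> R :=
  get (is_wpartial i u).

Fixpoint sobolev (k : nat) (r : \bar R) (u : point -> R) : Prop :=
  u \in Lfun mu r /\
  if k is k'.+1 then
    forall i, (exists v, is_wpartial i u v) /\ sobolev k' r (wpartial i u)
  else True.

(* (wgrad u)_(j, i) = d_j u_i, so that sigma *m wgrad u = (sigma . grad) u for
   row vectors *)
Definition wgrad (u : point -> 'rV[R]_d) : point -> 'M[R]_d :=
  fun x => \matrix_(j, i) wpartial j (component u i) x.

Definition wsymgrad (u : point -> 'rV[R]_d) : point -> 'M[R]_d :=
  fun x => 2^-1 *: (wgrad u x + (wgrad u x)^T).

Definition W1nm (r : R) (z : point -> 'rV[R]_d) : R :=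
  (Lnmx r z `^ r + Lnmx r (wgrad z) `^ r) `^ r^-1.

Definition Winf_nm (k : nat) (u : point -> 'rV[R]_d) : \bar R :=
  ereal_sup [set 'N[mu]_+oo[EFin \o foldr wpartial (component u l.1) l.2]%E |
    l in [set l : 'I_d * seq 'I_d | (size l.2 <= k)%N]].

Definition Winf_div (k : nat) (u : point -> 'rV[R]_d) :=
  (forall i, sobolev k +oo%E (component u i)) /\
  forall e : R, 0 < e -> exists phi : point -> 'rV[R]_d,
    [/\ forall i, smooth_on O (component phi i),
        forall x, domain_set O x -> \sum_i partial i (component phi i) x = 0,
        forall i, sobolev k +oo%E (component phi i) &
        (Winf_nm k (u \- phi)%R < e%:E)%E].

End function_spaces.

Definition conj_exp (R : realType) (p : R) : R := p / (p - 1).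

Definition norm_on (R : realType) (U : lmodType R) (A : set U) (N : U -> R) :=
  [/\ forall u, A u -> 0 <= N u,
      forall u, A u -> N u = 0 -> u = 0,
      forall a u, A u -> N (a *: u) = `|a| * N u &
      forall u v, A u -> A v -> N (u + v) <= N u + N v].

(* elements of Lebesgue spaces are represented by functions, hence linearity
   of the operators is required only almost everywhere, see is_grad_disc *)
Record grad_disc (R : realType) (d : nat) (X Y : vectType R) := GradDisc {
  gd_grad : X -> 'rV[R]_d -> 'M[R]_d;
  gd_eps : X -> 'rV[R]_d -> 'M[R]_d;
  gd_chi : Y -> 'rV[R]_d -> R;
  gd_div : X -> 'rV[R]_d -> R;
  gd_Pi : X -> 'rV[R]_d -> 'rV[R]_d }.

Section gradient_discretisation.
Context {R : realType} {d : nat} (O : polygonal_domain R d) (p : R).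
Context {X Y : vectType R} (D : grad_disc d X Y).
Local Notation point := 'rV[R]_d.
Local Notation mu := (leb_on O).
Local Notation p' := (conj_exp p).

Definition ae_linear (U V : lmodType R) (f : U -> point -> V) :=
  forall a u v, {ae mu, forall x, f (a *: u + v) x = a *: f u x + f v x}.

Definition gd_Y0 : set Y := [set q | \int[mu]_x gd_chi D q x = 0].

Definition gd_E0 : set X :=
  [set v | forall q, gd_Y0 q -> pair_fun O (gd_chi D q) (gd_div D v) = 0].

Record is_grad_disc : Prop := {
  gd_grad_linear : ae_linear (gd_grad D);
  gd_eps_linear : ae_linear (gd_eps D);
  gd_chi_linear : @ae_linear Y R^o (gd_chi D);
  gd_div_linear : @ae_linear X R^o (gd_div D);
  gd_Pi_linear : ae_linear (gd_Pi D);
  gd_grad_L : forall v, in_Lmx O p (gd_grad D v) /\ in_Lmx O p' (gd_grad D v);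
  gd_eps_L : forall v, in_Lmx O p (gd_eps D v) /\ in_Lmx O p' (gd_eps D v);
  gd_div_L : forall v, gd_div D v \in Lfun mu p%:E /\
                       gd_div D v \in Lfun mu p'%:E;
  gd_Pi_L : forall v, [/\ in_Lmx O 2 (gd_Pi D v), in_Lmx O p (gd_Pi D v) &
                          in_Lmx O p' (gd_Pi D v)];
  gd_chi_L : forall q, gd_chi D q \in Lfun mu (Num.min p p')%:E;
  gd_eps_norm : norm_on setT (fun v => Lnmx O p (gd_eps D v));
  gd_chi_norm : norm_on gd_Y0 (fun q => Lnm O (Num.min p p') (gd_chi D q));
  gd_Pi_inj : forall v w, gd_E0 v -> gd_E0 w ->
    {ae mu, forall x, gd_Pi D v x = gd_Pi D w x} -> v = w }.

(* defined by the same orthogonality relation on L^p and L^p', whose elements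
   can be paired with the values of gd_Pi D *)
Definition gd_K (u : point -> 'rV[R]_d) : X :=
  xget 0 [set w | gd_E0 w /\ forall xi, gd_E0 xi ->
    pair_mx O (u \- gd_Pi D w) (gd_Pi D xi) = 0].

(* the supremum over the empty set (X = 0) is -oo here *)
Definition gd_C (r : R) : \bar R :=
  ereal_sup [set ((Lnmx O r (gd_Pi D v) + Lnm O r (gd_div D v) +
                   Lnmx O r (gd_grad D v)) / Lnmx O r (gd_eps D v))%:E |
    v in [set v : X | v != 0]].

Definition gd_CSob (r : R) : \bar R :=
  ereal_sup [set (Lnmx O r (gd_eps D (gd_K z)) / W1nm O r z)%:E |
    z in [set z : point -> 'rV[R]_d |
      (forall i, sobolev O 1 r%:E (component z i)) /\ W1nm O r z != 0]].

Definition gd_beta : \bar R :=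
  ereal_inf [set
    ereal_sup [set (pair_fun O (gd_chi D q) (gd_div D v) /
      (Lnm O (Num.min p p') (gd_chi D q) *
       (Lnmx O p (gd_eps D v) + Lnmx O p' (gd_eps D v))))%:E |
      v in [set v : X | v != 0]] |
    q in [set q : Y | gd_Y0 q /\ q != 0]].

Definition gd_stable (Gamma : R) :=
  [/\ (gd_C p + gd_C p' <= Gamma%:E)%E,
      (Gamma^-1%:E <= gd_beta)%E &
      (gd_CSob p + gd_CSob p' <= Gamma%:E)%E].

End gradient_discretisation.

Section scheme.
Context {R : realType} {d : nat} (O : polygonal_domain R d).
Context (p kappa tau : R) (g sigma : 'rV[R]_d -> 'rV[R]_d).
Context {X Y : vectType R} (D : grad_disc d X Y).

Definition Sflux (A : 'M[R]_d) : 'M[R]_d :=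
  (kappa + enorm A ^+ 2) `^ ((p - 2) / 2) *: A.

Definition Bsigma (v xi : X) : R :=
  2^-1 * pair_mx O (fun x => sigma x *m gd_grad D v x) (gd_Pi D xi) -
  2^-1 * pair_mx O (gd_Pi D v) (fun x => sigma x *m gd_grad D xi x).

Definition CN_equation (v : X) (dW : R) (w xi : X) :=
  let u := 2^-1 *: (w + v) in
  pair_mx O (gd_Pi D w \- gd_Pi D v) (gd_Pi D xi) +
  tau * pair_mx O (fun x => Sflux (gd_eps D u x + wsymgrad O g x)) (gd_eps D xi)
  = (Bsigma u xi +
     pair_mx O (fun x => sigma x *m wgrad O g x) (gd_Pi D xi)) * dW.

Context {dOmega : measure_display} {Omega : measurableType dOmega}.
Variable P : probability Omega R.

(* E_(D,0)-valued random variables: measurability for the Borel sigma-algebra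
   of the finite-dimensional space X is that of the coordinates in a basis *)
Definition random_velocity (u : Omega -> X) :=
  (forall w, gd_E0 O D (u w)) /\
  forall i, measurable_fun setT (fun w => coord (vbasis {:X}) i (u w)).

Definition LqE_nm (q : R) (u : Omega -> X) : \bar R :=
  'N[P]_(q%:E)[(fun w => (Lnmx O 2 (gd_Pi D (u w)))%:E)]%E.

Definition LqE (q : R) (u : Omega -> X) :=
  random_velocity u /\ (LqE_nm q u < +oo)%E.

Definition CN_solution (v : Omega -> X) (dW : Omega -> R) (w : Omega -> X) :=
  random_velocity w /\
  forall xi, gd_E0 O D xi ->
    {ae P, forall om, CN_equation (v om) (dW om) (w om) xi}.

Definition CN_operator (S : (Omega -> X) -> (Omega -> R) -> (Omega -> X)) :=
  forall v dW, random_velocity v -> measurable_fun setT dW ->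
    CN_solution v dW (S v dW) /\
    forall w, CN_solution v dW w -> {ae P, forall om, w om = S v dW om}.

End scheme.

(* Main.v *)
Require Import Defs.
From HB Require Import structures.
From mathcomp Require Import all_boot all_order all_algebra.
From mathcomp Require Import lra ring.
From mathcomp Require Import all_classical all_reals all_analysis.
From mathcomp Require Import measurable_realfun.
Set Implicit Arguments.
Unset Strict Implicit.
Unset Printing Implicit Defensive.
Import Order.TTheory GRing.Theory Num.Theory.
Import numFieldNormedType.Exports.
Local Open Scope classical_set_scope.
Local Open Scope ring_scope.

(** The velocities form a finite-dimensional space [E] on which [|Pi .|_{L^2}] is
    a Hilbert norm.  By the Riesz theorem ([form_riesz]) every linear
    functional on [E], hence also every bilinear form ([bilinear_bounded]), is
    bounded for this norm.  This applies to the transport form, to the load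
    [((sigma . grad) g, Pi .)] and to the functional [(S(eps g), eps .)], so one
    time step becomes an implicit midpoint equation
    [<w - v, xi> + tau F(u, xi) = (B(u, xi) + l(xi)) W], with [u = (w + v) / 2],
    [B(a, a) = 0] and [F] monotone, because [S] is monotone pointwise
    ([Sflux_monotone]).

    Three choices of the test function give the three parts.  With [xi = u], the
    transport form vanishes and [|w| <= |v| + C (tau + |W|)], whatever the
    size of [W] ([midpoint_step_bound]): this is boundedness.  With the
    difference of two midpoints and a common update, what remains is
    [|w1 - w2| <= |v1 - v2|] ([midpoint_step_contract]): the Lipschitz constant
    is [1].  With the same test function and a common initial velocity,
    [|w1 - w2| <= C (1 + |v| + |W2|) |W1 - W2|] ([midpoint_step_update]).

    The last bound is a product of two random variables, and Hoelder's
    inequality would cost half of the integrability.  Continuity needs less: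
    the first bound also gives [|w1 - w2| <= C (1 + |v| + |W2| + |W1 - W2|)],
    and one uses the product where [Z = 1 + |v| + |W2|] is below a threshold and
    the sum where it is above, where [E(Z^q)] has a small tail ([Lnorm_small]).
    This argument runs entirely in [L^q], into which the data and their
    convergence are brought from the larger exponent by elementary comparison
    of powers ([Lnorm_lty_le], [powR_le_affine]).

    All of this rests on integrals that exist.  The domain has finite measure,
    so bounded fields lie in every Lebesgue space, [S] maps [L^p] to the
    conjugate space, and each pairing is an instance of Hoelder's inequality. *)

(** * Positive forms on finite-dimensional spaces *)

Section scalar_forms.
Context {R : realType} {X : lmodType R} (f : X -> R).
Hypothesis hf : scalar f.

Lemma scalarB u v : f (u - v) = f u - f v.
Proof. exact: zmod_morphism_linear hf _ _. Qed.

Lemma scalar0 : f 0 = 0.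
Proof. by rewrite -(subrr 0) scalarB subrr. Qed.

Lemma scalarD u v : f (u + v) = f u + f v.
Proof. by rewrite -[u]scale1r hf mul1r scale1r. Qed.

Lemma scalarZ a u : f (a *: u) = a * f u.
Proof. exact: scalable_linear hf _ _. Qed.

Lemma scalar_sum I (r : seq I) (F : I -> X) :
  f (\sum_(i <- r) F i) = \sum_(i <- r) f (F i).
Proof. by apply: (big_morph f scalarD scalar0). Qed.

End scalar_forms.

Section positive_form.
Context {R : realType} {X : vectType R} (G : X -> X -> R).
Hypotheses (Gl : forall b, scalar (G ^~ b)) (Gs : forall a b, G a b = G b a).
Hypothesis (G0 : forall a, 0 <= G a a).

Definition form_norm (a : X) : R := Num.sqrt (G a a).

Lemma form_scalarr a : scalar (G a).
Proof. by move=> k u v; rewrite Gs Gl 2!(Gs _ a). Qed.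

Lemma form_norm_ge0 a : 0 <= form_norm a.
Proof. exact: sqrtr_ge0. Qed.

Lemma sqr_form_norm a : form_norm a ^+ 2 = G a a.
Proof. by rewrite sqr_sqrtr. Qed.

(** Cauchy-Schwarz for a form that may degenerate: nonnegativity at
    [|b|^2 a - <a, b> b], or, when [|b| = 0], at [a + s b] with a large
    multiple [s] of sign opposite to [<a, b>]. *)
Lemma form_cauchy_schwarz a b : `|G a b| <= form_norm a * form_norm b.
Proof.
rewrite -sqrtrM// -[leLHS]sqrtr_sqr ler_sqrt; last by rewrite mulr_ge0.
have q x y : 0 <= x ^+ 2 * G a a + 2 * x * y * G a b + y ^+ 2 * G b b.
  have := G0 (x *: a + y *: b).
  rewrite (scalarD (Gl _)) !(scalarZ (Gl _)) !(scalarD (form_scalarr _)) !(scalarZ (form_scalarr _)).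
  by rewrite (Gs b a); congr (_ <= _); ring.
have [b0|bN0] := eqVneq (G b b) 0.
  rewrite b0 mulr0; suff -> : G a b = 0 by rewrite expr0n.
  apply/eqP/negP => /negP gN0.
  (* this coefficient makes the quadratic form equal to -1 *)
  have := q 1 (- (G a a + 1) / (2 * G a b)).
  rewrite b0 (_ : _ + _ = -1) ?oppr_ge0 ?ler10//.
  by field.
have b0 : 0 < G b b by rewrite lt_neqAle eq_sym bN0 G0.
have := q (G b b) (- G a b).
rewrite (_ : _ + _ = (G a a * G b b - G a b ^+ 2) * G b b); last by ring.
by rewrite pmulr_lge0// subr_ge0.
Qed.

Lemma form_normD a b : form_norm (a + b) <= form_norm a + form_norm b.
Proof.
rewrite -(@ler_pXn2r _ 2) ?nnegrE ?addr_ge0 ?form_norm_ge0//.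
rewrite sqr_form_norm (scalarD (Gl _)) !(scalarD (form_scalarr _)) (Gs b a).
have := le_trans (ler_norm _) (form_cauchy_schwarz a b).
by rewrite sqrrD !sqr_form_norm; lra.
Qed.

Lemma form_normZ k a : form_norm (k *: a) = `|k| * form_norm a.
Proof.
rewrite /form_norm (scalarZ (Gl _)) (scalarZ (form_scalarr _)) mulrA -expr2.
by rewrite sqrtrM ?sqr_ge0// sqrtr_sqr.
Qed.

Variables (V : {vspace X}).
Hypothesis Gpos : forall a, a \in V -> G a a = 0 -> a = 0.

(** Riesz representation: the Gram matrix of a basis of [V] is invertible
    because its left kernel consists of the coordinates of vectors of norm
    zero. *)
Lemma form_riesz (l : X -> R) : scalar l ->
  exists r, forall a, a \in V -> l a = G r a.
Proof.
move=> ll; pose b := vbasis V.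
pose M := \matrix_(i < \dim V, j < \dim V) G b`_i b`_j.
have Mu : M \in unitmx.
  rewrite -row_free_unit; apply: inj_row_free => c cM.
  pose x := \sum_i c 0 i *: b`_i.
  have xV : x \in V by apply/memv_suml => i _; rewrite memvZ// vbasis_mem ?mem_nth ?size_tuple.
  have xb (j : 'I_(\dim V)) : G x b`_j = 0.
    rewrite (scalar_sum (Gl _)).
    transitivity ((c *m M) 0 j); last by rewrite cM mxE.
    by rewrite mxE; apply: eq_bigr => i _; rewrite (scalarZ (Gl _)) mxE.
  have x0 : x = 0.
    apply: Gpos => //; rewrite {2}/x (scalar_sum (form_scalarr _)) big1// => i _.
    by rewrite (scalarZ (form_scalarr _)) xb mulr0.
  have /freeP := basis_free (vbasisP V) => /(_ (c 0) x0) c0.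
  by apply/rowP => i; rewrite c0 mxE.
have [c cM] : exists c, c *m M = \row_j l b`_j.
  by exists ((\row_j l b`_j) *m invmx M); rewrite mulmxKV.
exists (\sum_i c 0 i *: b`_i) => a aV.
rewrite (coord_vbasis aV) (scalar_sum ll) (scalar_sum (form_scalarr _)).
apply: eq_bigr => j _; rewrite (scalarZ ll) (scalarZ (form_scalarr _)); congr (_ * _).
rewrite (scalar_sum (Gl _)).
transitivity ((c *m M) 0 j); first by rewrite cM mxE.
by rewrite mxE; apply: eq_bigr => i _; rewrite (scalarZ (Gl _)) mxE.
Qed.

Lemma scalar_bounded (l : X -> R) : scalar l ->
  exists2 C, 0 <= C & forall a, a \in V -> `|l a| <= C * form_norm a.
Proof.
move=> /form_riesz[r lr]; exists (form_norm r) => [|a /lr ->].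
  exact: form_norm_ge0.
exact: form_cauchy_schwarz.
Qed.

(** The first argument is expanded in a basis, whose coordinates are themselves
    bounded functionals. *)
Lemma bilinear_bounded (B : X -> X -> R) :
    (forall a, scalar (B a)) -> (forall b, scalar (B ^~ b)) ->
  exists2 C, 0 <= C & forall a b, a \in V -> b \in V ->
    `|B a b| <= C * form_norm a * form_norm b.
Proof.
move=> Br Bl; pose e := vbasis V.
have /all_sig2[Ce Ce0 CeP] (i : 'I_(\dim V)) := cid2 (scalar_bounded (Br e`_i)).
have cl (i : 'I_(\dim V)) : scalar (fun a => coord e i a).
  by move=> k u v; rewrite linearP.
have /all_sig2[Cc Cc0 CcP] i := cid2 (scalar_bounded (cl i)).
exists (\sum_i Ce i * Cc i) => [|a b aV bV].
  by rewrite sumr_ge0// => i _; rewrite mulr_ge0.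
rewrite {1}(coord_vbasis aV) (scalar_sum (Bl _)) !mulr_suml.
apply: (le_trans (ler_norm_sum _ _ _)); apply: ler_sum => i _.
rewrite (scalarZ (Bl _)) normrM.
rewrite (_ : _ * _ * _ * _ = (Cc i * form_norm a) * (Ce i * form_norm b)); last by ring.
by apply: ler_pM => //; [exact: CcP|exact: CeP].
Qed.

End positive_form.

(** A subspace given by a predicate is the detachable subspace of largest
    dimension that it contains. *)
Lemma vspace_of_closed (R : realType) (X : vectType R) (E : set X) :
    E 0 -> (forall k u v, E u -> E v -> E (k *: u + v)) ->
  exists V : {vspace X}, forall x, x \in V <-> E x.
Proof.
move=> E0 El.
pose Q n := `[< exists2 V : {vspace X}, \dim V = n & forall x, x \in V -> E x >].
have exQ : exists n, Q n.
  by exists 0%N; apply/asboolP; exists 0%VS; rewrite ?dimv0// => x; rewrite memv0 => /eqP ->.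
have ubQ n : Q n -> (n <= \dim {:X})%N.
  by move=> /asboolP[V <- _]; apply: dimvS; exact: subvf.
have [n /asboolP[V dV VE] Vmax] := ex_maxnP exQ ubQ.
exists V => x; split; first exact: VE.
move=> Ex; apply: contrapT => /negP xV.
have : Q (\dim (<[x]> + V)%VS).
  apply/asboolP; exists (<[x]> + V)%VS => // y /memv_addP[_ /vlineP[k ->] [v vV ->]].
  by apply: El => //; exact: VE.
move=> /Vmax; rewrite -dV leqNgt => /negP; apply.
rewrite ltn_neqAle dimvS ?addvSr// andbT; apply: contra xV => /eqP dE.
have /eqP VE' : V == (<[x]> + V)%VS by rewrite eqEdim addvSr dE leqnn.
by rewrite VE' memvE addvSl.
Qed.

(** * One step of the scheme in a finite-dimensional energy space *)

Section midpoint_step.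
Context {R : realType} {X : vectType R} (E : set X).
Context (G B F : X -> X -> R) (l : X -> R) (tau C : R).
Hypotheses (Gl : forall b, scalar (G ^~ b)) (Gs : forall a b, G a b = G b a).
Hypothesis (G0 : forall a, 0 <= G a a).
Hypotheses (Bl : forall b, scalar (B ^~ b)) (Br : forall a, scalar (B a)).
Hypothesis (Ba : forall a, B a a = 0).
Hypothesis (Fmono : forall a b, F b (a - b) <= F a (a - b)).
Hypothesis (ll : scalar l).
Hypotheses (E0 : E 0) (El : forall k u v, E u -> E v -> E (k *: u + v)).
Hypotheses (tau0 : 0 < tau) (C0 : 0 <= C).
Local Notation n := (form_norm G).
Hypothesis (BC : forall a b, E a -> E b -> `|B a b| <= C * n a * n b).
Hypothesis (lC : forall a, E a -> `|l a| <= C * n a).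
Hypothesis (FC : forall a, E a -> `|F 0 a| <= C * n a).

(** [G] is the inner product, [B] the transport form, [F] the flux and [l] the
    load; [W] is the value of the update at one outcome. *)
Definition midpoint_step (v : X) (W : R) (w : X) :=
  forall xi, E xi ->
  G (w - v) xi + tau * F (2^-1 *: (w + v)) xi =
  (B (2^-1 *: (w + v)) xi + l xi) * W.

Let ED u v : E u -> E v -> E (u + v).
Proof. by move=> Eu Ev; rewrite -[u]scale1r; exact: El. Qed.

Let EZ k u : E u -> E (k *: u).
Proof. by move=> Eu; rewrite -[_ *: u]addr0; exact: El. Qed.

Let EB u v : E u -> E v -> E (u - v).
Proof. by move=> Eu Ev; rewrite -scaleN1r; apply: ED => //; exact: EZ. Qed.

Let n0 a : 0 <= n a := form_norm_ge0 G a.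

Let polar a b : G (a - b) (2^-1 *: (a + b)) = 2^-1 * (n a ^+ 2 - n b ^+ 2).
Proof.
rewrite (scalarZ (form_scalarr Gl Gs _)) (scalarD (form_scalarr Gl Gs _)) !(scalarB (Gl _)) (Gs b a).
by rewrite !sqr_form_norm//; congr (_ * _); ring.
Qed.

Let half_norm a b : n (2^-1 *: (a + b)) <= 2^-1 * (n a + n b).
Proof.
rewrite form_normZ// ger0_norm ?invr_ge0// ler_pM2l ?invr_gt0//.
exact: form_normD.
Qed.

(** Testing with the midpoint removes the transport form, and by monotonicity
    the flux is bounded below by its value at the zero velocity. *)
Lemma midpoint_step_bound v W w : E v -> E w -> midpoint_step v W w ->
  n w <= n v + C * (tau + `|W|).
Proof.
move=> Ev Ew /(_ (2^-1 *: (w + v)) (EZ _ (ED Ew Ev))).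
set u := 2^-1 *: (w + v); rewrite polar Ba add0r => eqn.
have Eu : E u by apply/EZ/ED.
have Fu : - (C * n u) <= F u u.
  have := Fmono u 0; rewrite subr0; apply: le_trans.
  by have := FC Eu; rewrite ler_norml => /andP[].
have lW : l u * W <= C * n u * `|W|.
  by apply: le_trans (ler_norm _) _; rewrite normrM ler_wpM2r// lC.
have key : n w ^+ 2 - n v ^+ 2 <= C * (tau + `|W|) * (n w + n v).
  apply: (@le_trans _ _ (2 * (C * (tau + `|W|) * n u))); last first.
    rewrite mulrCA ler_wpM2l// ?mulr_ge0 ?addr_ge0 ?(ltW tau0)//.
    by have := half_norm w v; rewrite -/u; lra.
  have : tau * - (C * n u) <= tau * F u u by rewrite ler_pM2l.
  move: eqn lW; set A := C * n u; rewrite (_ : C * _ * n u = A * tau + A * `|W|).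
    by lra.
  by rewrite /A; ring.
have [s0|s0] := eqVneq (n w + n v) 0.
  have := n0 w; have := n0 v; have : 0 <= C * (tau + `|W|).
    by rewrite mulr_ge0 ?addr_ge0 ?(ltW tau0).
  lra.
have {s0}s0 : 0 < n w + n v by rewrite lt_neqAle eq_sym s0 addr_ge0.
by rewrite -lerBlDl -(ler_pM2r s0) -subr_sqr.
Qed.

(** Two steps are compared by testing the difference of their equations with
    the difference of the midpoints: monotonicity discards the flux, and the
    antisymmetry of the transport form leaves only its contribution from the
    difference of the updates. *)
Lemma midpoint_step_energy v1 v2 W1 W2 w1 w2 :
    E v1 -> E v2 -> E w1 -> E w2 ->
    midpoint_step v1 W1 w1 -> midpoint_step v2 W2 w2 ->
  n (w1 - w2) ^+ 2 <= n (v1 - v2) ^+ 2 +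
    (B (2^-1 *: (w2 + v2)) ((w1 - w2) + (v1 - v2)) +
     l ((w1 - w2) + (v1 - v2))) * (W1 - W2).
Proof.
move=> Ev1 Ev2 Ew1 Ew2 e1 e2.
set a := w1 - w2; set b := v1 - v2.
have Ex : E (2^-1 *: (a + b)) by apply/EZ/ED; exact: EB.
have {e1} := e1 _ Ex; have {e2} := e2 _ Ex; move: Ex.
set u1 := 2^-1 *: (w1 + v1); set u2 := 2^-1 *: (w2 + v2).
set x := 2^-1 *: (a + b) => Ex.
have xE : x = u1 - u2 by rewrite /x /u1 /u2 -scalerBr opprD addrACA.
have Gx : G (w1 - v1) x - G (w2 - v2) x = 2^-1 * (n a ^+ 2 - n b ^+ 2).
  rewrite -(scalarB (Gl _)) -polar /a /b !opprB [v2 - w2]addrC [v2 - v1]addrC.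
  by rewrite addrACA.
have Fx : F u2 x <= F u1 x by rewrite xE.
have Bx : B u1 x = B u2 x.
  by apply/eqP; rewrite -subr_eq0 -(scalarB (Bl _)) -xE Ba.
have Bab : B u2 x = 2^-1 * B u2 (a + b) by rewrite (scalarZ (Br _)).
have lab : l x = 2^-1 * l (a + b) by rewrite (scalarZ ll).
move: Gx Fx; rewrite Bx lab Bab -(ler_pM2l tau0).
lra.
Qed.

(** With a common update the right-hand side of the energy inequality vanishes,
    however large the update is. *)
Lemma midpoint_step_contract v1 v2 W w1 w2 :
    E v1 -> E v2 -> E w1 -> E w2 ->
    midpoint_step v1 W w1 -> midpoint_step v2 W w2 ->
  n (w1 - w2) <= n (v1 - v2).
Proof.
move=> Ev1 Ev2 Ew1 Ew2 e1 e2.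
have := midpoint_step_energy Ev1 Ev2 Ew1 Ew2 e1 e2.
by rewrite subrr mulr0 addr0 ler_pXn2r ?nnegrE.
Qed.

(** The remaining transport term is linear in [w1 - w2], so one factor of its norm
    cancels; the midpoint of the second step is controlled by its data. *)
Lemma midpoint_step_update v W1 W2 w1 w2 :
    E v -> E w1 -> E w2 ->
    midpoint_step v W1 w1 -> midpoint_step v W2 w2 ->
  n (w1 - w2) <= C * (1 + n v + C * (tau + `|W2|)) * `|W1 - W2|.
Proof.
move=> Ev Ew1 Ew2 e1 e2.
have := midpoint_step_energy Ev Ev Ew1 Ew2 e1 e2.
have -> : n (v - v) = 0 by rewrite subrr /form_norm (scalar0 (Gl _)) sqrtr0.
rewrite expr0n add0r subrr addr0.
set a := w1 - w2; set u := 2^-1 *: (w2 + v).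
have Ea : E a by exact: EB.
have Eu : E u by apply/EZ/ED.
have nu : n u <= n v + C * (tau + `|W2|).
  have := half_norm w2 v; have := midpoint_step_bound Ev Ew2 e2.
  have : 0 <= C * (tau + `|W2|) by rewrite mulr_ge0 ?addr_ge0 ?(ltW tau0).
  rewrite -/u; lra.
set K := 1 + n v + C * (tau + `|W2|).
have rhs : (B u a + l a) * (W1 - W2) <= C * K * n a * `|W1 - W2|.
  apply: le_trans (ler_norm _) _; rewrite normrM ler_wpM2r//.
  apply: le_trans (ler_normD _ _) _.
  apply: (@le_trans _ _ (C * n u * n a + C * n a)).
    by apply: lerD; [exact: BC|exact: lC].
  rewrite (_ : _ + _ = C * (1 + n u) * n a); last by ring.
  by rewrite ler_wpM2r// ler_wpM2l// /K -addrA lerD2l.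
move=> /le_trans /(_ rhs).
have [->|a0] := eqVneq (n a) 0.
  by move=> _; rewrite !mulr_ge0 ?addr_ge0 ?(ltW tau0)// mulr_ge0 ?addr_ge0 ?(ltW tau0).
have {a0}a0 : 0 < n a by rewrite lt_neqAle eq_sym a0 n0.
by rewrite expr2 mulrAC ler_pM2r.
Qed.

End midpoint_step.

(** * Moments of random variables *)

Section moments.
Context {d : measure_display} {T : measurableType d} {R : realType}.
Variable P : probability T R.
Implicit Types (f g h Z : T -> R) (q a b c : R).
Local Open Scope ereal_scope.

Definition moment q f : \bar R := \int[P]_x (`|f x| `^ q)%:E.

Lemma moment_ge0 q f : 0 <= moment q f.
Proof. by apply: integral_ge0 => x _; rewrite lee_fin powR_ge0. Qed.

Let root_le (r a q : R) : (0 < q)%R -> (0 <= r)%R -> (0 <= a)%R ->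
  (r `^ q^-1 <= a)%R = (r <= a `^ q)%R.
Proof.
move=> q0 r0 a0; apply/idP/idP => h.
  by rewrite -[r]powRr1// -(mulVf (lt0r_neq0 q0)) powRrM ge0_ler_powR ?nnegrE ?powR_ge0 ?(ltW q0).
rewrite -[a]powRr1// -(mulfV (lt0r_neq0 q0)) powRrM.
by rewrite ge0_ler_powR ?nnegrE ?powR_ge0// invr_ge0 ltW.
Qed.

Let root_lt (r a q : R) : (0 < q)%R -> (0 <= r)%R -> (0 <= a)%R ->
  (r `^ q^-1 < a)%R = (r < a `^ q)%R.
Proof.
move=> q0 r0 a0; rewrite !ltNge; congr (~~ _).
have := @root_le (a `^ q) (r `^ q^-1) q q0 (powR_ge0 _ _) (powR_ge0 _ _).
by rewrite -!powRrM mulfV ?mulVf ?gt_eqF// !powRr1.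
Qed.

Lemma Lnorm_le_moment q f a : (0 < q)%R -> (0 <= a)%R ->
  ('N[P]_(q%:E)[EFin \o f] <= a%:E) = (moment q f <= (a `^ q)%:E).
Proof.
move=> q0 a0; rewrite unlock /Lnorm -[(\int[_]_x _)]/(moment q f).
case: (moment q f) (moment_ge0 q f) => [r||//]; first by rewrite poweR_EFin !lee_fin => r0; exact: root_le.
by rewrite poweRyr ?invr_eq0 ?gt_eqF.
Qed.

Lemma Lnorm_lt_moment q f a : (0 < q)%R -> (0 <= a)%R ->
  ('N[P]_(q%:E)[EFin \o f] < a%:E) = (moment q f < (a `^ q)%:E).
Proof.
move=> q0 a0; rewrite unlock /Lnorm -[(\int[_]_x _)]/(moment q f).
case: (moment q f) (moment_ge0 q f) => [r||//]; last by rewrite poweRyr ?invr_eq0 ?gt_eqF.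
by rewrite poweR_EFin lee_fin !lte_fin => r0; exact: root_lt.
Qed.

Lemma Lnorm_lty_moment q f : (0 < q)%R ->
  ('N[P]_(q%:E)[EFin \o f] < +oo) = (moment q f < +oo).
Proof.
move=> q0; rewrite unlock /Lnorm -[(\int[_]_x _)]/(moment q f).
apply/idP/idP => [|/poweR_lty]; last by apply.
by apply: lty_poweRy; rewrite invr_eq0 gt_eqF.
Qed.

Lemma measurable_moment q f : measurable_fun setT f ->
  measurable_fun setT (fun x => `|f x| `^ q)%R.
Proof.
move=> mf; apply: (measurableT_comp (measurable_powR _)).
exact: measurableT_comp.
Qed.

Lemma Lnorm_le q f g : (0 < q)%R ->
    measurable_fun setT f -> measurable_fun setT g ->
    {ae P, forall x, `|f x| <= `|g x|}%R ->
  'N[P]_(q%:E)[EFin \o f] <= 'N[P]_(q%:E)[EFin \o g].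
Proof.
move=> q0 mf mg fg; rewrite unlock /Lnorm -!/(moment q _).
have fg' : moment q f <= moment q g.
  apply: ae_ge0_le_integral => //; try exact/measurable_EFinP/measurable_moment.
  by apply: filterS fg => x fx _; rewrite lee_fin ge0_ler_powR ?nnegrE// ltW.
by apply: gt0_ler_poweR; rewrite ?invr_ge0 ?(ltW q0)// in_itv/= moment_ge0 leey.
Qed.

Lemma ae_integral_affine f g h a b c :
    measurable_fun setT f -> measurable_fun setT g -> measurable_fun setT h ->
    (forall x, 0 <= f x)%R -> (forall x, 0 <= g x)%R -> (forall x, 0 <= h x)%R ->
    (0 <= a)%R -> (0 <= b)%R -> (0 <= c)%R ->
    {ae P, forall x, f x <= a + b * g x + c * h x}%R ->
  \int[P]_x (f x)%:E <=
    a%:E + b%:E * \int[P]_x (g x)%:E + c%:E * \int[P]_x (h x)%:E.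
Proof.
move=> mf mg mh f0 g0 h0 a0 b0 c0 fgh.
have mbg : measurable_fun setT (fun x => (b * g x)%:E).
  by apply/measurable_EFinP; exact: measurable_funM.
have mch : measurable_fun setT (fun x => (c * h x)%:E).
  by apply/measurable_EFinP; exact: measurable_funM.
have bg0 x : 0 <= (b * g x)%:E by rewrite lee_fin mulr_ge0.
have ch0 x : 0 <= (c * h x)%:E by rewrite lee_fin mulr_ge0.
have mca : measurable_fun [set: T] (fun=> a%:E) by exact: measurable_cst.
have mabg : measurable_fun [set: T] (fun x => a%:E + (b * g x)%:E).
  exact: emeasurable_funD.
have abg0 x : 0 <= a%:E + (b * g x)%:E by rewrite adde_ge0.
have -> : a%:E + b%:E * \int[P]_x (g x)%:E + c%:E * \int[P]_x (h x)%:E =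
   \int[P]_x (a%:E + (b * g x)%:E + (c * h x)%:E).
  rewrite ge0_integralD// ge0_integralD//.
  rewrite integral_cst// [X in a%:E * X](probability_setT P) mule1.
  by rewrite -!ge0_integralZl ?lee_fin//; first [exact/measurable_EFinP|move=> x _; rewrite lee_fin].
apply: ae_ge0_le_integral => //.
- by move=> x _; rewrite lee_fin.
- exact/measurable_EFinP.
- by move=> x _; rewrite !adde_ge0.
- exact: emeasurable_funD.
- by apply: filterS fgh => x fx _; rewrite -!EFinD lee_fin.
Qed.

(** The power of a sum is controlled by the largest term, which avoids
    convexity and so covers the exponents below [1]. *)
Lemma powR_sum3_le q a b c : (0 <= q)%R -> (0 <= a)%R -> (0 <= b)%R -> (0 <= c)%R ->
  ((a + b + c) `^ q <= 3 `^ q * (a `^ q + b `^ q + c `^ q))%R.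
Proof.
move=> q0 a0 b0 c0.
wlog bc : b c b0 c0 / (b <= c)%R => [H|].
  have [bc|/ltW cb] := leP b c; first exact: H.
  by rewrite addrAC [(_ + _ + c `^ q)%R]addrAC; exact: H.
have key m : (0 <= m)%R -> (a <= m)%R -> (c <= m)%R ->
    ((a + b + c) `^ q <= 3 `^ q * m `^ q)%R.
  move=> m0 am cm; rewrite -powRM// ge0_ler_powR ?nnegrE ?addr_ge0 ?mulr_ge0//.
  lra.
have := powR_ge0 a q; have := powR_ge0 b q; have := powR_ge0 c q.
have [ac|/ltW ca] := leP a c.
  move=> ? ? ?; apply: le_trans (key c _ _ _) _ => //.
  by rewrite ler_wpM2l ?powR_ge0//; lra.
move=> ? ? ?; apply: le_trans (key a _ _ _) _ => //.
by rewrite ler_wpM2l ?powR_ge0//; lra.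
Qed.

(** The bound depends on the data only through [M], which is what boundedness of
    a nonlinear operator requires. *)
Lemma Lnorm_affine_bound q (K M : R) : (0 < q)%R -> (0 <= K)%R ->
  exists C : R, forall f g h,
    measurable_fun setT f -> measurable_fun setT g -> measurable_fun setT h ->
    {ae P, forall x, `|f x| <= K * (1 + `|g x| + `|h x|)}%R ->
    'N[P]_(q%:E)[EFin \o g] <= M%:E -> 'N[P]_(q%:E)[EFin \o h] <= M%:E ->
    'N[P]_(q%:E)[EFin \o f] <= C%:E.
Proof.
move=> q0 K0; pose k := (K `^ q * 3 `^ q)%R.
pose c := (k + k * M `^ q + k * M `^ q)%R.
have k0 : (0 <= k)%R by rewrite mulr_ge0 ?powR_ge0.
have c0 : (0 <= c)%R by rewrite !addr_ge0 ?mulr_ge0 ?powR_ge0.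
exists (c `^ q^-1)%R => f g h mf mg mh fgh gM hM.
have M0 : (0 <= M)%R by rewrite -lee_fin; apply: le_trans gM; exact: Lnorm_ge0.
move: gM hM; rewrite !Lnorm_le_moment ?powR_ge0//.
rewrite -powRrM mulVf ?gt_eqF// powRr1// => gM hM.
have : moment q f <= k%:E + k%:E * moment q g + k%:E * moment q h.
  apply: ae_integral_affine => //; try exact: measurable_moment.
  apply: filterS fgh => x fx; apply: (@le_trans _ _ ((K * (1 + `|g x| + `|h x|)) `^ q)%R).
    by rewrite ge0_ler_powR ?nnegrE ?mulr_ge0 ?addr_ge0// ltW.
  rewrite powRM ?addr_ge0// -[X in (_ <= X + _ + _)%R]mulr1 -!mulrDr -mulrA ler_wpM2l ?powR_ge0//.
  have := powR_sum3_le (ltW q0) ler01 (normr_ge0 (g x)) (normr_ge0 (h x)).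
  by rewrite powR1.
move=> /le_trans; apply; rewrite /c !EFinD !EFinM.
by rewrite !leeD// lee_wpmul2l ?lee_fin.
Qed.

Lemma Lnorm_affine_lty q (K : R) f g h : (0 < q)%R -> (0 <= K)%R ->
    measurable_fun setT f -> measurable_fun setT g -> measurable_fun setT h ->
    {ae P, forall x, `|f x| <= K * (1 + `|g x| + `|h x|)}%R ->
    'N[P]_(q%:E)[EFin \o g] < +oo -> 'N[P]_(q%:E)[EFin \o h] < +oo ->
  'N[P]_(q%:E)[EFin \o f] < +oo.
Proof.
move=> q0 K0 mf mg mh fgh.
rewrite -ge0_fin_numE ?Lnorm_ge0// => /fineK gE.
rewrite -ge0_fin_numE ?Lnorm_ge0// => /fineK hE.
have [C CP] := Lnorm_affine_bound
  (Num.max (fine 'N[P]_(q%:E)[EFin \o g]) (fine 'N[P]_(q%:E)[EFin \o h])) q0 K0.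
apply: le_lt_trans (CP f g h mf mg mh fgh _ _) (ltry _).
  by rewrite -gE lee_fin le_max lexx.
by rewrite -hE lee_fin le_max lexx orbT.
Qed.

(** Lyapunov's inclusion between the spaces of random variables with finite
    moments. *)
Lemma Lnorm_lty_le q q' f : (0 < q)%R -> (q <= q')%R -> measurable_fun setT f ->
  'N[P]_(q'%:E)[EFin \o f] < +oo -> 'N[P]_(q%:E)[EFin \o f] < +oo.
Proof.
move=> q0 qq' mf; rewrite !Lnorm_lty_moment ?(lt_le_trans q0)// => foo.
have : moment q f <= 1%:E + 1%:E * moment q' f + 0%:E * moment q' f.
  apply: ae_integral_affine => //; try exact: measurable_moment.
  apply: aeW => x; rewrite mul1r mul0r addr0.
  have [f1|f1] := leP `|f x|%R 1%R.
    rewrite (le_trans (@ge0_ler_powR _ q (ltW q0) `|f x|%R 1%R _ _ _)) ?nnegrE//.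
    by rewrite powR1 lerDl powR_ge0.
  by rewrite (le_trans (ler_powR (ltW f1) qq'))// lerDr.
move=> /le_lt_trans; apply; rewrite mul1e mul0e adde0.
by rewrite lte_add_pinfty// ltry.
Qed.

Definition tail_part (N : R) Z (x : T) : R := if (Z x <= N)%R then 0%R else Z x.

Lemma measurable_tail_part N Z : measurable_fun setT Z -> measurable_fun setT (tail_part N Z).
Proof.
move=> mZ; apply: measurable_fun_ifT => //.
exact: measurable_fun_ler.
Qed.

(** Dominated convergence: the truncations vanish pointwise and are dominated by
    [|Z|^q]. *)
Lemma moment_tail q Z (e : R) : (0 < q)%R -> (0 < e)%R ->
    measurable_fun setT Z -> moment q Z < +oo ->
  exists2 N : R, (0 <= N)%R & moment q (tail_part N Z) < e%:E.
Proof.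
move=> q0 e0 mZ Zoo.
have cvg0 : moment q (tail_part n%:R Z) @[n --> \oo] --> 0.
  have mt n : measurable_fun setT (fun x => (`|tail_part n%:R Z x| `^ q)%:E).
    by apply/measurable_EFinP/measurable_moment/measurable_tail_part.
  have m0 : measurable_fun [set: T] (cst (0 : \bar R)) by exact: measurable_cst.
  have t0 : {ae P, forall x, [set: T] x ->
      (`|tail_part n%:R Z x| `^ q)%:E @[n --> \oo] --> (0 : \bar R)}.
    apply: aeW => x _; apply: cvg_near_cst; near=> n.
    rewrite /tail_part ifT ?normr0 ?powR0 ?gt_eqF//.
    apply: (le_trans (ler_norm _)); near: n; exact: nbhs_infty_ger.
  have iZ : P.-integrable setT (fun x => (`|Z x| `^ q)%:E).
    apply/integrableP; split; first by apply/measurable_EFinP/measurable_moment.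
    by under eq_integral do rewrite gee0_abs ?lee_fin ?powR_ge0//.
  have dom : {ae P, forall x n, [set: T] x ->
      `|(`|tail_part n%:R Z x| `^ q)%:E| <= (`|Z x| `^ q)%:E}.
    apply: aeW => x n _; rewrite gee0_abs ?lee_fin ?powR_ge0// /tail_part.
    by case: ifP => // _; rewrite normr0 powR0 ?gt_eqF// powR_ge0.
  have [_ _] := dominated_convergence measurableT mt m0 t0 iZ dom.
  by rewrite integral_cst// mul0e.
move: cvg0=> /fine_cvgP[_]; set u := (X in X @ _ --> _).
move=> /cvgr_lt /(_ e e0) [n _ /(_ n (leqnn n)) /= nlt].
exists n%:R => //; rewrite -[moment _ _]fineK ?lte_fin//.
rewrite ge0_fin_numE ?moment_ge0//; apply: le_lt_trans Zoo.
apply: ge0_le_integral => //.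
- by apply/measurable_EFinP/measurable_moment/measurable_tail_part.
- by apply/measurable_EFinP/measurable_moment.
- move=> x _; rewrite lee_fin /tail_part; case: ifP => // _.
  by rewrite normr0 powR0 ?gt_eqF// powR_ge0.
Unshelve. all: by end_near. Qed.

(** A quantitative form of the inclusion of moments: the additive constant can be
    made small, at the price of a large factor, so that convergence in [L^q']
    implies convergence in [L^q] for all exponents [0 < q <= q']. *)
Lemma powR_le_affine (q q' t eta : R) : (0 < q)%R -> (q <= q')%R -> (0 <= t)%R ->
  (0 < eta)%R -> (t `^ q <= eta + eta `^ (1 - q' / q) * t `^ q')%R.
Proof.
move=> q0 qq' t0 eta0; have [te|te] := leP (t `^ q)%R eta.
  by rewrite (le_trans te)// lerDl mulr_ge0 ?powR_ge0.
have tq0 : (t `^ q != 0)%R by rewrite gt_eqF// (lt_trans eta0).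
rewrite (_ : t `^ q' = t `^ q * (t `^ q) `^ (q' / q - 1))%R; last first.
  rewrite -{1}[(t `^ q)%R]powRr1 ?powR_ge0// -powRD; last by rewrite tq0 implybT.
  by rewrite subrKC -powRrM mulrCA divff ?mulr1 ?gt_eqF.
rewrite mulrCA ler_wpDl ?(ltW eta0)// ler_peMr ?powR_ge0//.
rewrite -opprB powRN mulrC ler_pdivlMr ?powR_gt0// mul1r.
rewrite ge0_ler_powR ?nnegrE ?powR_ge0 ?(ltW te) ?(ltW eta0)//.
by rewrite subr_ge0 ler_pdivlMr// mul1r.
Qed.

(** A random variable with two bounds, one that is small with [h] but has a
    product on the right and one that is only a sum, is small in [L^q]: the
    product bound is used where [Z] is at most [N], and where [Z] exceeds [N]
    the sum bound leaves a tail of the moment of [Z].  No moment of the product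
    is ever taken. *)
Lemma Lnorm_small q q' (C e : R) Z : (0 < q)%R -> (q <= q')%R -> (0 <= C)%R ->
    (0 < e)%R -> measurable_fun setT Z -> (forall x, 0 <= Z x)%R ->
    'N[P]_(q%:E)[EFin \o Z] < +oo ->
  exists2 delta : R, (0 < delta)%R & forall f h,
    measurable_fun setT f -> measurable_fun setT h ->
    {ae P, forall x, `|f x| <= C * Z x * `|h x|}%R ->
    {ae P, forall x, `|f x| <= C * (Z x + `|h x|)}%R ->
    'N[P]_(q'%:E)[EFin \o h] < delta%:E -> 'N[P]_(q%:E)[EFin \o f] < e%:E.
Proof.
move=> q0 qq' C0 e0 mZ Z0; rewrite Lnorm_lty_moment// => Zoo.
have q'0 : (0 < q')%R by exact: lt_le_trans qq'.
(* each of the three terms of the estimate below may use a third of [e ^ q] *)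
set E := (e `^ q / 3)%R; have E0 : (0 < E)%R by rewrite divr_gt0 ?powR_gt0.
pose small (k : R) : R := (E / (k + 1))%R.
have small0 k : (0 <= k)%R -> (0 < small k)%R by move=> k0; rewrite divr_gt0// ltr_wpDl.
have smallE k : (0 <= k)%R -> (k * small k <= E)%R.
  move=> k0; rewrite mulrCA ler_piMr ?(ltW E0)// ler_pdivrMr ?ltr_wpDl// mul1r.
  by rewrite lerDl.
set k := ((2 * C) `^ q)%R; have k0 : (0 <= k)%R by exact: powR_ge0.
have [N N0 ZN] := moment_tail q0 (small0 _ k0) mZ Zoo.
set K := ((2 * C * (N + 1)) `^ q)%R; have K0 : (0 <= K)%R by exact: powR_ge0.
set eta := small K; have eta0 : (0 < eta)%R by exact: small0.
set L := (K * eta `^ (1 - q' / q))%R.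
have L0 : (0 <= L)%R by rewrite mulr_ge0 ?powR_ge0.
exists (small L `^ q'^-1)%R; first by rewrite powR_gt0 ?small0.
move=> f h mf mh fprod fsum; rewrite !Lnorm_lt_moment ?powR_ge0 ?(ltW e0)//.
rewrite -powRrM mulVf ?gt_eqF// powRr1 ?(ltW (small0 _ L0))// => hd.
have pw : {ae P, forall x,
    `|f x| `^ q <= K * eta + L * `|h x| `^ q' + k * `|tail_part N Z x| `^ q}%R.
  apply: filterS2 fprod fsum => x fp fs.
  have kt : (0 <= k * `|tail_part N Z x| `^ q)%R by rewrite mulr_ge0 ?powR_ge0.
  have viah : (`|f x| <= 2 * C * (N + 1) * `|h x|)%R ->
      (`|f x| `^ q <= K * eta + L * `|h x| `^ q' + k * `|tail_part N Z x| `^ q)%R.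
    move=> fh; rewrite ler_wpDr//; apply: (@le_trans _ _ (K * `|h x| `^ q)%R).
      rewrite -powRM ?mulr_ge0 ?addr_ge0// ge0_ler_powR ?nnegrE ?mulr_ge0 ?addr_ge0//.
      exact: ltW.
    by rewrite -mulrA -mulrDr ler_wpM2l// powR_le_affine.
  have N1 : (C * N <= 2 * C * (N + 1))%R.
    by rewrite [(2 * C)%R]mulrC -mulrA ler_wpM2l//; lra.
  have C1 : (2 * C <= 2 * C * (N + 1))%R by rewrite ler_peMr ?mulr_ge0// lerDr.
  have [ZxN|NZx] := leP (Z x) N.
    apply: viah; apply: le_trans fp _; rewrite ler_wpM2r//.
    by apply: le_trans N1; rewrite ler_wpM2l.
  have [hZ|/ltW Zh] := leP `|h x|%R (Z x).
    apply: (@le_trans _ _ (k * `|tail_part N Z x| `^ q)%R); last first.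
      rewrite lerDr; apply: addr_ge0; first by rewrite mulr_ge0 ?(ltW eta0).
      by rewrite mulr_ge0 ?powR_ge0.
    have -> : tail_part N Z x = Z x by rewrite /tail_part leNgt NZx.
    rewrite [`|Z x|%R]ger0_norm// -powRM ?mulr_ge0//.
    rewrite ge0_ler_powR ?nnegrE ?mulr_ge0 ?(ltW q0)//.
    apply: le_trans fs _; rewrite [(2 * C)%R]mulrC -mulrA ler_wpM2l//; lra.
  apply: viah; apply: le_trans fs _; apply: (@le_trans _ _ (2 * C * `|h x|)%R).
    by rewrite [(2 * C)%R]mulrC -mulrA ler_wpM2l//; lra.
  by rewrite ler_wpM2r.
have := @ae_integral_affine _ _ _ (K * eta)%R L k
  (measurable_moment q mf) (measurable_moment q' mh)
  (measurable_moment q (measurable_tail_part N mZ)) (fun=> powR_ge0 _ _)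
  (fun=> powR_ge0 _ _) (fun=> powR_ge0 _ _) (mulr_ge0 K0 (ltW eta0)) L0 k0 pw.
move=> /le_lt_trans; apply; rewrite -/(moment _ _).
move: hd ZN; rewrite -!/(moment _ _).
have := moment_ge0 q' h; have := moment_ge0 q (tail_part N Z).
case: (moment q' h) => [a||]//; case: (moment q (tail_part N Z)) => [b||]//.
rewrite !lee_fin !lte_fin => b0 a0 ad bd.
have e3 : (e `^ q = E + E + E)%R by rewrite /E; lra.
rewrite e3.
have := smallE _ K0; have := smallE _ L0; have := smallE _ k0; rewrite -/eta.
have : (L * a <= L * small L)%R by rewrite ler_wpM2l// ltW.
have [k00|kN0] := eqVneq k 0%R.
  by rewrite k00 !mul0r; lra.
have : (k * b < k * small k)%R by rewrite ltr_pM2l// lt_neqAle eq_sym kN0.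
lra.
Qed.

End moments.

(** * Integrable pairings *)

Section Lfun_tools.
Context {d : measure_display} {T : measurableType d} {R : realType}.
Variable mu : {measure set T -> \bar R}.
Implicit Types (f g h : T -> R).

Lemma Lfun_measurable (r : \bar R) f : f \in Lfun mu r -> measurable_fun setT f.
Proof. by rewrite inE => /andP[]; rewrite inE. Qed.

Lemma LfunE (r : R) f : 0 < r ->
  f \in Lfun mu r%:E <->
  measurable_fun setT f /\ (\int[mu]_x (`|f x| `^ r)%:E < +oo)%E.
Proof.
move=> r0; have E : ('N[mu]_(r%:E)[EFin \o f] < +oo)%E <->
    (\int[mu]_x (`|f x| `^ r)%:E < +oo)%E.
  rewrite unlock /Lnorm; split; last exact: poweR_lty.
  by apply: lty_poweRy; rewrite invr_eq0 gt_eqF.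
split=> [fr|[mf /E foo]].
  split; first exact: Lfun_measurable fr.
  by apply/E; move: fr; rewrite inE => /andP[_]; rewrite inE.
by rewrite inE; apply/andP; split; rewrite inE.
Qed.

Lemma measurable_norm_powR (r : R) f : measurable_fun setT f ->
  measurable_fun setT (fun x => (`|f x| `^ r)%:E).
Proof.
move=> mf; apply/measurable_EFinP/(measurableT_comp (measurable_powR _)).
exact: measurableT_comp.
Qed.

Lemma Lfun_ae_dominated (r : R) f h : 0 < r -> measurable_fun setT f ->
  {ae mu, forall x, `|f x| <= `|h x|} -> h \in Lfun mu r%:E -> f \in Lfun mu r%:E.
Proof.
move=> r0 mf fh /(LfunE h r0)[mh hoo]; apply/LfunE => //; split => //.
apply: le_lt_trans hoo; apply: ae_ge0_le_integral => //.
- exact: measurable_norm_powR.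
- exact: measurable_norm_powR.
- apply: filterS fh => x fx _.
  by rewrite lee_fin ge0_ler_powR ?nnegrE// ltW.
Qed.

Lemma LfunZD (r : R) a f h : 1 <= r ->
  f \in Lfun mu r%:E -> h \in Lfun mu r%:E ->
  (fun x => a * f x + h x) \in Lfun mu r%:E.
Proof. by move=> r1; have [_] := @Lfun_submod_closed _ _ _ mu r%:E r1; exact. Qed.

Lemma Lfun0 (r : R) : 1 <= r -> (fun=> 0) \in Lfun mu r%:E.
Proof. by move=> r1; have [] := @Lfun_submod_closed _ _ _ mu r%:E r1. Qed.

Lemma Lfun_sum (r : R) I (s : seq I) (F : I -> T -> R) : 1 <= r ->
  (forall i, F i \in Lfun mu r%:E) ->
  (fun x => \sum_(i <- s) F i x) \in Lfun mu r%:E.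
Proof.
move=> r1 Fr; elim: s => [|i s IH].
  by under eq_fun do rewrite big_nil; exact: Lfun0.
under eq_fun do rewrite big_cons -[F i _]mul1r.
exact: LfunZD.
Qed.

Lemma Lfun_normr (r : R) f : 0 < r ->
  f \in Lfun mu r%:E -> (fun x => `|f x|) \in Lfun mu r%:E.
Proof.
move=> r0 fr; apply: (Lfun_ae_dominated r0 _ _ fr).
  by apply: measurableT_comp => //; exact: Lfun_measurable fr.
by apply: aeW => x; rewrite normr_id.
Qed.

(** When the measure vanishes, the supremum norm carries no information, but then
    every bound holds almost everywhere. *)
Lemma Lfun_bounded f : f \in Lfun mu +oo%E ->
  exists M : R, {ae mu, forall x, `|f x| <= M}.
Proof.
rewrite inE => /andP[/[!inE] mf]; rewrite /= /finite_norm unlock /Lnorm.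
case: ifPn => [mu0 /ess_sup_inf.ess_supr_bounded//|].
rewrite -leNgt => mu0 _; exists 0; exists setT; split => //.
by apply/eqP; rewrite eq_le mu0 measure_ge0.
Qed.

Lemma Lfun_mul_bounded (r : R) f h : 1 <= r ->
  f \in Lfun mu +oo%E -> h \in Lfun mu r%:E -> (fun x => f x * h x) \in Lfun mu r%:E.
Proof.
move=> r1 foo hr; have r0 : 0 < r by exact: lt_le_trans r1.
have [M fM] := Lfun_bounded foo.
have Mh : (fun x => M * h x + 0) \in Lfun mu r%:E.
  by apply: (@LfunZD r M h (fun=> 0)) => //; exact: Lfun0.
apply: (Lfun_ae_dominated r0 _ _ Mh).
  by apply: measurable_funM; [exact: Lfun_measurable foo|exact: Lfun_measurable hr].
apply: filterS fM => x fx; rewrite addr0 !normrM ler_wpM2r//.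
exact: le_trans fx (ler_norm _).
Qed.

Lemma Lfun_mul_integrable (r s : R) f h : 0 < r -> 0 < s -> r^-1 + s^-1 = 1 ->
  f \in Lfun mu r%:E -> h \in Lfun mu s%:E ->
  mu.-integrable setT (fun x => (f x * h x)%:E).
Proof.
move=> r0 s0 rs fr hs.
have mf := Lfun_measurable fr; have mh := Lfun_measurable hs.
apply/integrableP; split; first by apply/measurable_EFinP; exact: measurable_funM.
have := hoelder mu mf mh r0 s0 rs; rewrite Lnorm1 => /le_lt_trans; apply.
rewrite lte_mul_pinfty ?Lnorm_ge0//.
  rewrite ge0_fin_numE ?Lnorm_ge0//.
  by move: fr; rewrite inE => /andP[_]; rewrite inE.
by move: hs; rewrite inE => /andP[_]; rewrite inE.
Qed.

(** The power map that sends [L^r] to the conjugate space. *)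
Lemma Lfun_powR (r s : R) h : 0 < r -> 0 < s -> (r - 1) * s = r ->
  (forall x, 0 <= h x) ->
  h \in Lfun mu r%:E -> (fun x => h x `^ (r - 1)) \in Lfun mu s%:E.
Proof.
move=> r0 s0 rs h0 /(LfunE h r0)[mh hoo]; apply/LfunE => //; split.
  exact: (measurableT_comp (measurable_powR _)).
apply: le_lt_trans hoo; rewrite le_eqVlt; apply/orP; left; apply/eqP.
apply: eq_integral => x _.
by rewrite ger0_norm ?powR_ge0// -powRrM rs ger0_norm.
Qed.

Lemma Rintegral_ae_lin f f1 f2 a :
  mu.-integrable setT (EFin \o f) -> mu.-integrable setT (EFin \o f1) ->
  mu.-integrable setT (EFin \o f2) ->
  {ae mu, forall x, f x = a * f1 x + f2 x} ->
  \int[mu]_x f x = a * \int[mu]_x f1 x + \int[mu]_x f2 x.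
Proof.
move=> If If1 If2 fE.
have Iaf1 : mu.-integrable setT (EFin \o (fun x => a * f1 x)).
  by under [X in integrable _ _ X]eq_fun do rewrite /= EFinM; exact: integrableZl.
rewrite -RintegralZl// -RintegralD//; congr fine.
apply: ae_eq_integral => //; first exact: measurable_int If.
  apply/measurable_EFinP/measurable_funD; apply/measurable_EFinP.
    exact: measurable_int Iaf1.
  exact: measurable_int If2.
by apply: filterS fE => x fx _; rewrite fx.
Qed.

Lemma Rintegral_ae_ge0 f : mu.-integrable setT (EFin \o f) ->
  {ae mu, forall x, 0 <= f x} -> 0 <= \int[mu]_x f x.
Proof.
move=> /(measurable_int mu) mf f0; apply: fine_ge0.
rewrite (ae_eq_integral (fun x => (Num.max 0 (f x))%:E))//.
- by apply: integral_ge0 => x _; rewrite lee_fin le_max lexx.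
- by apply/measurable_EFinP/measurable_maxr => //; exact/measurable_EFinP.
- by apply: filterS f0 => x fx _; rewrite max_r.
Qed.

End Lfun_tools.

Section matrix_pairing.
Context {R : realType} {m n : nat}.
Implicit Types A B : 'M[R]_(m, n).

Lemma mxdotC A B : mxdot A B = mxdot B A.
Proof. by apply: eq_bigr => i _; apply: eq_bigr => j _; rewrite mulrC. Qed.

Lemma mxdot_scalar B : scalar (fun A => mxdot A B).
Proof.
move=> k A A'; rewrite /mxdot mulr_sumr -big_split; apply: eq_bigr => i _ /=.
rewrite mulr_sumr -big_split; apply: eq_bigr => j _ /=.
by rewrite !mxE mulrDl mulrA.
Qed.

Lemma mxdotBl A A' B : mxdot (A - A') B = mxdot A B - mxdot A' B.
Proof. exact: scalarB (mxdot_scalar B) _ _. Qed.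

Lemma mxdot_ge0 A : 0 <= mxdot A A.
Proof. by apply: sumr_ge0 => i _; apply: sumr_ge0 => j _; rewrite -expr2 sqr_ge0. Qed.

Lemma sqr_enorm A : enorm A ^+ 2 = mxdot A A.
Proof. by rewrite sqr_sqrtr ?mxdot_ge0. Qed.

Lemma enorm_ge0 A : 0 <= enorm A.
Proof. exact: sqrtr_ge0. Qed.

Lemma mxdot_le A B : mxdot A B <= enorm A * enorm B.
Proof.
by apply: le_trans (ler_norm _) _; apply: (form_cauchy_schwarz mxdot_scalar mxdotC mxdot_ge0).
Qed.

Lemma entry_le_enorm A i j : `|A i j| <= enorm A.
Proof.
rewrite -sqrtr_sqr ler_sqrt ?mxdot_ge0// /mxdot (bigD1 i)//= (bigD1 j)//=.
rewrite -expr2 -addrA lerDl addr_ge0//.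
  by apply: sumr_ge0 => k _; rewrite -expr2 sqr_ge0.
by apply: sumr_ge0 => k _; apply: sumr_ge0 => l _; rewrite -expr2 sqr_ge0.
Qed.

Lemma enorm_le_sum A : enorm A <= \sum_i \sum_j `|A i j|.
Proof.
set S := \sum_i \sum_j `|A i j|.
have entry i j : `|A i j| <= S.
  rewrite /S (bigD1 i)//= (bigD1 j)//= -addrA lerDl addr_ge0//.
    exact: sumr_ge0.
  by apply: sumr_ge0 => k _; exact: sumr_ge0.
have S0 : 0 <= S by apply: sumr_ge0 => i _; exact: sumr_ge0.
rewrite -(ger0_norm S0) -sqrtr_sqr ler_sqrt ?sqr_ge0//.
rewrite expr2 {1}/S mulr_suml; apply: ler_sum => i _.
rewrite mulr_suml; apply: ler_sum => j _.
rewrite -expr2 -real_normK ?num_real// expr2.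
by rewrite ler_wpM2l.
Qed.

End matrix_pairing.

Section flux.
Context {R : realType} {d : nat} (p kappa : R).
Hypotheses (hp : 1 < p) (hkappa : 0 <= kappa).
Implicit Types A B : 'M[R]_d.

Let phi (s : R) := (kappa + s ^+ 2) `^ ((p - 2) / 2).

Let phi_factor s : 0 < s ->
  s * phi s = s / Num.sqrt (kappa + s ^+ 2) * (kappa + s ^+ 2) `^ ((p - 1) / 2).
Proof.
move=> s0; have k0 : 0 < kappa + s ^+ 2 by rewrite ltr_wpDl// exprn_gt0.
rewrite /phi -mulrA; congr (_ * _).
rewrite (_ : (p - 2) / 2 = (p - 1) / 2 - 2^-1); last by field.
by rewrite powRB ?(gt_eqF k0) ?implybT// powR12_sqrt ?(ltW k0)// mulrC.
Qed.

(** The modulus of the flux is a product of two nondecreasing factors, a bounded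
    one and a power with positive exponent; this covers [p < 2] and [p >= 2]
    at once. *)
Lemma flux_modulus_homo (s t : R) : 0 <= s -> s <= t ->
  s * (kappa + s ^+ 2) `^ ((p - 2) / 2) <= t * (kappa + t ^+ 2) `^ ((p - 2) / 2).
Proof.
rewrite -!/(phi _) le_eqVlt => /predU1P[<- t0|s0 st].
  by rewrite mul0r mulr_ge0 ?powR_ge0.
have t0 : 0 < t by exact: lt_le_trans st.
have ks : 0 < kappa + s ^+ 2 by rewrite ltr_wpDl// exprn_gt0.
have kt : 0 < kappa + t ^+ 2 by rewrite ltr_wpDl// exprn_gt0.
have s2t2 : s ^+ 2 <= t ^+ 2 by rewrite ler_pXn2r ?nnegrE ?(ltW s0) ?(ltW t0).
rewrite !phi_factor//; apply: ler_pM; rewrite ?powR_ge0//.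
- by rewrite divr_ge0 ?sqrtr_ge0// ltW.
- rewrite ler_pdivrMr ?sqrtr_gt0// mulrAC ler_pdivlMr ?sqrtr_gt0//.
  rewrite -(@ler_pXn2r _ 2) ?nnegrE ?mulr_ge0 ?sqrtr_ge0 ?(ltW s0) ?(ltW t0)//.
  rewrite !exprMn !sqr_sqrtr ?(ltW ks) ?(ltW kt)// !mulrDr.
  by rewrite [X in _ + X]mulrC lerD2r ler_wpM2r.
- rewrite ge0_ler_powR ?nnegrE ?(ltW ks) ?(ltW kt) ?lerD2l//.
  by rewrite divr_ge0// subr_ge0 ltW.
Qed.

Lemma Sflux_monotone A B : 0 <= mxdot (Sflux p kappa A - Sflux p kappa B) (A - B).
Proof.
have Gr (C : 'M[R]_d) : scalar (mxdot C) := form_scalarr mxdot_scalar mxdotC C.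
rewrite (scalarB (mxdot_scalar _)) !(scalarB (Gr _)).
rewrite /Sflux -!/(phi _) !(scalarZ (mxdot_scalar _)) (mxdotC B A) -!sqr_enorm.
set a := enorm A; set b := enorm B.
have AB : (phi a + phi b) * mxdot A B <= (phi a + phi b) * (a * b).
  by rewrite ler_wpM2l ?addr_ge0 ?powR_ge0// mxdot_le.
have : 0 <= (a * phi a - b * phi b) * (a - b).
  have [ab|/ltW ba] := leP a b.
    by rewrite mulr_le0// subr_le0// flux_modulus_homo ?enorm_ge0.
  by rewrite mulr_ge0// subr_ge0// flux_modulus_homo ?enorm_ge0.
move: AB; lra.
Qed.

Lemma Sflux_growth A i j :
  `|Sflux p kappa A i j| <= Num.sqrt (kappa + enorm A ^+ 2) `^ (p - 1).
Proof.
have A0 := enorm_ge0 A; rewrite mxE normrM (ger0_norm (powR_ge0 _ _)).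
have [a0|aN0] := eqVneq (enorm A) 0.
  have := entry_le_enorm A i j; rewrite a0 normr_le0 => /eqP ->.
  by rewrite normr0 mulr0 powR_ge0.
have {aN0}a0 : 0 < enorm A by rewrite lt_neqAle eq_sym aN0.
apply: (@le_trans _ _ (enorm A * phi (enorm A))).
  by rewrite mulrC ler_wpM2r ?powR_ge0// entry_le_enorm.
have k0 : 0 < kappa + enorm A ^+ 2 by rewrite ltr_wpDl// exprn_gt0.
rewrite phi_factor// -powR12_sqrt ?(ltW k0)// -powRrM [2^-1 * _]mulrC.
rewrite ler_piMl ?powR_ge0// powR12_sqrt ?(ltW k0)//.
rewrite ler_pdivrMr ?sqrtr_gt0// mul1r.
rewrite -(@ler_pXn2r _ 2) ?nnegrE ?sqrtr_ge0//.
by rewrite [leRHS]sqr_sqrtr ?(ltW k0)// lerDr.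
Qed.

End flux.

Section bounded_domain.
Context {R : realType} {d : nat} (O : polygonal_domain R d).

(** A bounded set lies in a box, whose measure is a finite product. *)
Lemma leb_on_fin_num : leb_on O setT \is a fin_num.
Proof.
have [M [_ /(_ (M + 1))]] := domain_bounded O.
rewrite ltrDl ltr01 => /(_ isT) OM.
pose box := [set x : 'rV[R]_d |
  forall i, (`[- (M + 1), M + 1]%classic : set (measurableTypeR R)) (x 0 i)].
have mbox : measurable box.
  rewrite (_ : box = \bigcap_(i in [set: 'I_d])
    ((fun x : 'rV[R]_d => x 0 i) @^-1` `[- (M + 1), M + 1]%classic)); last first.
    by apply/seteqP; split => x /= H i; [move=> _|]; exact: H.
  apply: fin_bigcap_measurable => // i _.
  by rewrite -[X in measurable X]setTI; apply: measurable_coord_rV.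
have Obox : setT `&` domain_set O `<=` box.
  move=> x [_ Ox] i; rewrite /= in_itv/= -ler_norml.
  apply: le_trans (OM x Ox); rewrite [leRHS]/Num.Def.normr/= mx_normrE.
  exact: (le_bigmax _ (fun j => `|x j.1 j.2|) (0, i)).
have box_fin : lebesgue_rV d box \is a fin_num.
  rewrite (@lebesgue_rV_box R d (fun=> `[- (M + 1), M + 1]%classic))//.
  apply: prode_fin_num => i _; rewrite /= lebesgue_measure_itv/=.
  by case: ifP.
rewrite ge0_fin_numE ?measure_ge0//; move: box_fin.
rewrite ge0_fin_numE ?measure_ge0//; apply: le_lt_trans.
apply: le_measure => //; rewrite inE//; apply: measurableI => //.
exact: (open_measurable_rV (@domain_open R d O)).
Qed.

Implicit Types (m n : nat).

Lemma pair_mx_integrable (r s : R) m n (F H : 'rV[R]_d -> 'M[R]_(m, n)) :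
  0 < r -> 0 < s -> r^-1 + s^-1 = 1 -> in_Lmx O r F -> in_Lmx O s H ->
  (leb_on O).-integrable setT (EFin \o (fun x => mxdot (F x) (H x))).
Proof.
move=> r0 s0 rs Fr Hs; apply/Lfun1_integrable.
apply: (Lfun_sum (r := 1)) => // i; apply: (Lfun_sum (r := 1)) => // j.
by apply/Lfun1_integrable; exact: (Lfun_mul_integrable r0 s0 rs).
Qed.

Lemma pair_mx_lin (r s a : R) m n (F F1 F2 H : 'rV[R]_d -> 'M[R]_(m, n)) :
    0 < r -> 0 < s -> r^-1 + s^-1 = 1 ->
    in_Lmx O r F -> in_Lmx O r F1 -> in_Lmx O r F2 -> in_Lmx O s H ->
    {ae leb_on O, forall x, F x = a *: F1 x + F2 x} ->
  pair_mx O F H = a * pair_mx O F1 H + pair_mx O F2 H.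
Proof.
move=> r0 s0 rs Fr F1r F2r Hs FE; apply: Rintegral_ae_lin.
- exact: pair_mx_integrable Fr Hs.
- exact: pair_mx_integrable F1r Hs.
- exact: pair_mx_integrable F2r Hs.
- by apply: filterS FE => x ->; exact: mxdot_scalar.
Qed.

Lemma pair_mxC m n (F H : 'rV[R]_d -> 'M[R]_(m, n)) : pair_mx O F H = pair_mx O H F.
Proof. by apply: eq_Rintegral => x _; rewrite mxdotC. Qed.

Lemma in_LmxD (r : R) m n (F H : 'rV[R]_d -> 'M[R]_(m, n)) : 1 <= r ->
  in_Lmx O r F -> in_Lmx O r H -> in_Lmx O r (fun x => F x + H x).
Proof.
move=> r1 Fr Hr i j; under eq_fun do rewrite mxE -[F _ i j]mul1r.
exact: LfunZD.
Qed.

(** Each entry is a sum of products of a bounded function with a function in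
    [L^r]. *)
Lemma in_Lmx_row_mul (r : R) n (sigma : 'rV[R]_d -> 'rV[R]_d)
    (F : 'rV[R]_d -> 'M[R]_(d, n)) : 1 <= r ->
  (forall i, component sigma i \in Lfun (leb_on O) +oo%E) ->
  in_Lmx O r F -> in_Lmx O r (fun x => sigma x *m F x).
Proof.
move=> r1 soo Fr i j; under eq_fun do rewrite mxE.
apply: Lfun_sum => // k; rewrite ord1.
exact: (Lfun_mul_bounded r1 (soo k)).
Qed.

(** [|S(A)|] is at most [sqrt (kappa + |A|^2) ^ (p - 1)], and the square root lies in
    [L^p] because it is below [sqrt kappa] plus the sum of the moduli of the
    entries. *)
Lemma in_Lmx_Sflux (p kappa : R) (F : 'rV[R]_d -> 'M[R]_d) : 1 < p -> 0 <= kappa ->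
  in_Lmx O p F -> in_Lmx O (conj_exp p) (fun x => Sflux p kappa (F x)).
Proof.
move=> p1 k0 Fp i j; have p0 : 0 < p by exact: lt_trans p1.
have p10 : 0 < p - 1 by rewrite subr_gt0.
have q0 : 0 < conj_exp p by rewrite divr_gt0.
have mF k l := Lfun_measurable (Fp k l).
have mn : measurable_fun setT (fun x => kappa + enorm (F x) ^+ 2).
  apply: measurable_funD => //; under eq_fun do rewrite sqr_enorm /mxdot.
  by apply: measurable_sum => k; apply: measurable_sum => l; exact: measurable_funM.
have kp : (fun=> kappa) \in Lfun (leb_on O) p%:E.
  apply/LfunE => //; split => //.
  by rewrite integral_cst// ltey_eq fin_numM// leb_on_fin_num.
have hp : (fun x => Num.sqrt (kappa + enorm (F x) ^+ 2)) \in Lfun (leb_on O) p%:E.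
  have Sp : (fun x => \sum_k \sum_l `|F x k l|) \in Lfun (leb_on O) p%:E.
    apply: Lfun_sum (ltW p1) _ => k; apply: Lfun_sum (ltW p1) _ => l.
    exact: Lfun_normr.
  have : (fun x => Num.sqrt kappa + \sum_k \sum_l `|F x k l|) \in Lfun (leb_on O) p%:E.
    have sp : (fun=> Num.sqrt kappa) \in Lfun (leb_on O) p%:E.
      apply/LfunE => //; split => //.
      by rewrite integral_cst// ltey_eq fin_numM// leb_on_fin_num.
    by under eq_fun do rewrite -[X in X + _]mul1r; exact: LfunZD (ltW p1) _ _.
  apply: Lfun_ae_dominated => //.
    apply: (measurableT_comp _ mn); exact: continuous_measurable_fun (@sqrt_continuous R).
  apply: aeW => x; rewrite (ger0_norm (sqrtr_ge0 _)) ger0_norm; last first.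
    by rewrite addr_ge0 ?sqrtr_ge0//; apply: sumr_ge0 => ? _; exact: sumr_ge0.
  apply: (@le_trans _ _ (Num.sqrt kappa + enorm (F x))); last first.
    by rewrite lerD2l enorm_le_sum.
  rewrite -(@ler_pXn2r _ 2) ?nnegrE ?sqrtr_ge0 ?addr_ge0 ?sqrtr_ge0 ?enorm_ge0//.
  rewrite [leLHS]sqr_sqrtr ?addr_ge0 ?exprn_ge0 ?enorm_ge0// sqrrD [Num.sqrt kappa ^+ 2]sqr_sqrtr//.
  by rewrite -addrA lerD2l lerDr mulrn_wge0// mulr_ge0 ?sqrtr_ge0.
have hq := Lfun_powR p0 q0 _ (fun x => sqrtr_ge0 _) hp.
have {}hq := hq (_ : (p - 1) * conj_exp p = p).
apply: Lfun_ae_dominated (hq _) => //; last first.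
- by rewrite /conj_exp mulrC divfK// gt_eqF.
- apply: aeW => x; rewrite [leRHS]ger0_norm ?powR_ge0//.
  exact: Sflux_growth.
under eq_fun do rewrite mxE.
apply: measurable_funM => //.
exact: (measurableT_comp (measurable_powR _)).
Qed.

End bounded_domain.

Lemma conj_expP (R : realType) (p : R) : 1 < p ->
  1 < conj_exp p /\ p^-1 + (conj_exp p)^-1 = 1.
Proof.
move=> p1; have p10 : 0 < p - 1 by rewrite subr_gt0.
split; first by rewrite /conj_exp ltr_pdivlMr// mul1r ltrBlDr ltrDl.
rewrite /conj_exp; have : p != 0 by rewrite gt_eqF// (lt_trans ltr01).
by move=> pN0; rewrite invf_div; field.
Qed.

Section data_fields.
Context {R : realType} {d : nat} (O : polygonal_domain R d).

Lemma Winf_div_bounded k (u : 'rV[R]_d -> 'rV[R]_d) i :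
  Winf_div O k u -> component u i \in Lfun (leb_on O) +oo%E.
Proof. by case=> /(_ i) + _; case: k => [|k] []. Qed.

Lemma Winf_div_grad_bounded k (u : 'rV[R]_d -> 'rV[R]_d) i j :
  Winf_div O k.+1 u -> wpartial O j (component u i) \in Lfun (leb_on O) +oo%E.
Proof. by case=> /(_ i)/= [_ /(_ j)[_ +]] _; case: k => [|k] []. Qed.

Lemma in_Lmx_wgrad (r : R) k (u : 'rV[R]_d -> 'rV[R]_d) : 1 <= r ->
  Winf_div O k.+1 u -> in_Lmx O r (wgrad O u).
Proof.
move=> r1 hu i j; under eq_fun do rewrite mxE.
have r1' : (1 <= r%:E)%E by rewrite lee_fin.
apply: (Lfun_subset r1' (leey _) (leb_on_fin_num O) (leey _)).
exact: Winf_div_grad_bounded hu.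
Qed.

Lemma in_Lmx_wsymgrad (r : R) k (u : 'rV[R]_d -> 'rV[R]_d) : 1 <= r ->
  Winf_div O k.+1 u -> in_Lmx O r (wsymgrad O u).
Proof.
move=> r1 /(in_Lmx_wgrad r1) ur i j.
have -> : (fun x => wsymgrad O u x i j) =
    fun x => 2^-1 * wgrad O u x i j + (2^-1 * wgrad O u x j i + 0).
  apply/funext => x; rewrite /wsymgrad addr0 -mulrDr.
  by move: (wgrad O u x) => A; rewrite !mxE.
by apply: LfunZD => //; apply: LfunZD => //; exact: Lfun0.
Qed.

End data_fields.

(** * The forms of the scheme *)

Section scheme_forms.
Context {R : realType} {d : nat} (O : polygonal_domain R d).
Context (p kappa tau : R) (hp : 1 < p) (hkappa : 0 <= kappa) (htau : 0 < tau).
Context (g sigma : 'rV[R]_d -> 'rV[R]_d).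
Context (hg : Winf_div O 2 g) (hsigma : Winf_div O 1 sigma).
Context {X Y : vectType R} (D : grad_disc d X Y) (hD : is_grad_disc O p D).

Local Notation mu := (leb_on O).
Local Notation p' := (conj_exp p).
Local Notation E := (gd_E0 O D).

Let p0 : 0 < p. Proof. exact: lt_trans hp. Qed.
Let p'1 : 1 < p'. Proof. by have [] := conj_expP hp. Qed.
Let p'0 : 0 < p'. Proof. exact: lt_trans p'1. Qed.
Let pp' : p^-1 + p'^-1 = 1. Proof. by have [] := conj_expP hp. Qed.
Let p'p : p'^-1 + p^-1 = 1. Proof. by rewrite addrC. Qed.
Let two0 : 0 < 2 :> R. Proof. by []. Qed.
Let two2 : 2^-1 + 2^-1 = 1 :> R. Proof. by rewrite [RHS]splitr mul1r. Qed.

Let Pi2 v : in_Lmx O 2 (gd_Pi D v). Proof. by have [] := gd_Pi_L hD v. Qed.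
Let Pip v : in_Lmx O p (gd_Pi D v). Proof. by have [] := gd_Pi_L hD v. Qed.
Let Pip' v : in_Lmx O p' (gd_Pi D v). Proof. by have [] := gd_Pi_L hD v. Qed.
Let epsp v : in_Lmx O p (gd_eps D v). Proof. by have [] := gd_eps_L hD v. Qed.

Definition transport (v : X) (x : 'rV[R]_d) : 'rV[R]_d := sigma x *m gd_grad D v x.

Let sgp v : in_Lmx O p (transport v).
Proof.
apply: in_Lmx_row_mul (ltW hp) _ _ => [i|]; first exact: Winf_div_bounded hsigma.
by have [] := gd_grad_L hD v.
Qed.

Let sgp' v : in_Lmx O p' (transport v).
Proof.
apply: in_Lmx_row_mul (ltW p'1) _ _ => [i|]; first exact: Winf_div_bounded hsigma.
by have [] := gd_grad_L hD v.
Qed.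

Let transport_linear a u v :
  {ae mu, forall x, transport (a *: u + v) x = a *: transport u x + transport v x}.
Proof.
apply: filterS (gd_grad_linear hD a u v) => x.
by rewrite /transport => ->; rewrite mulmxDr scalemxAr.
Qed.

Definition mass (v w : X) := pair_mx O (gd_Pi D v) (gd_Pi D w).

Definition flux_form (u xi : X) :=
  pair_mx O (fun x => Sflux p kappa (gd_eps D u x + wsymgrad O g x)) (gd_eps D xi).

Definition load (xi : X) :=
  pair_mx O (fun x => sigma x *m wgrad O g x) (gd_Pi D xi).

Lemma mass_scalar w : scalar (mass ^~ w).
Proof.
move=> a u v; apply: (pair_mx_lin two0 two0 two2) => //.
exact: gd_Pi_linear hD a u v.
Qed.

Lemma massC v w : mass v w = mass w v.
Proof. exact: pair_mxC. Qed.

Lemma mass_ge0 v : 0 <= mass v v.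
Proof. by apply: Rintegral_ge0 => x _; exact: mxdot_ge0. Qed.

Lemma Lnmx2 m n (F : 'rV[R]_d -> 'M[R]_(m, n)) :
  Lnmx O 2 F = Num.sqrt (pair_mx O F F).
Proof.
rewrite /Lnmx /Lnm unlock /Lnorm fine_poweR powR12_sqrt; last first.
  by rewrite fine_ge0// integral_ge0// => x _; rewrite lee_fin powR_ge0.
congr Num.sqrt; apply: eq_Rintegral => x _.
by rewrite /= -[2]/(2%:R) powR_mulrn// ger0_norm ?enorm_ge0// sqr_enorm.
Qed.

Lemma Lnmx_mass v : Lnmx O 2 (gd_Pi D v) = form_norm mass v.
Proof. exact: Lnmx2. Qed.

Lemma gd_E0_closed : E 0 /\ forall k u v, E u -> E v -> E (k *: u + v).
Proof.
have lin q : scalar (fun v => pair_fun O (gd_chi D q) (gd_div D v)).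
  have chi_div v : mu.-integrable setT (fun x => (gd_chi D q x * gd_div D v x)%:E).
    have [divp divp'] := gd_div_L hD v; have := gd_chi_L hD q.
    have [_|_] := leP p p' => chi.
      exact: (Lfun_mul_integrable p0 p'0 pp').
    exact: (Lfun_mul_integrable p'0 p0 p'p).
  move=> a u v; apply: Rintegral_ae_lin; [exact: chi_div..|].
  apply: filterS (gd_div_linear hD a u v) => x ->.
  by rewrite mulrDr mulrCA.
split=> [q _|k u v Eu Ev q q0]; first exact: scalar0 (lin q).
by rewrite (lin q) Eu// Ev// mulr0 addr0.
Qed.

(** Definiteness on [E] is the injectivity of the reconstruction there: a zero
    mass makes it vanish almost everywhere. *)
Lemma mass_pos v : E v -> mass v v = 0 -> v = 0.
Proof.
move=> Ev v0; have [E0 _] := gd_E0_closed.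
apply: (gd_Pi_inj hD) => //.
have Pi0 : {ae mu, forall x, gd_Pi D 0 x = 0}.
  apply: filterS (gd_Pi_linear hD (-1) 0 0) => x.
  by rewrite scaleN1r addNr scaleN1r addNr.
have intPi : mu.-integrable setT (EFin \o (fun x => mxdot (gd_Pi D v x) (gd_Pi D v x))).
  exact: (pair_mx_integrable two0 two0 two2).
have mI := measurable_int _ intPi.
have I0 : (\int[mu]_x `|(mxdot (gd_Pi D v x) (gd_Pi D v x))%:E| = 0)%E.
  under eq_integral do rewrite gee0_abs ?lee_fin ?mxdot_ge0//.
  rewrite -[LHS]fineK; last exact: integrable_fin_num intPi.
  by move: v0; rewrite /mass /pair_mx /Rintegral => ->.
have := (ae_eq_integral_abs mu measurableT mI).1 I0.
apply: filterS2 Pi0 => x -> /(_ I)[] x0.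
apply/matrixP => i j; rewrite mxE; apply/eqP; rewrite -normr_le0.
by apply: le_trans (entry_le_enorm _ i j) _; rewrite /enorm x0 sqrtr0.
Qed.

Lemma Bsigma_scalarl xi : scalar (Bsigma O sigma D ^~ xi).
Proof.
move=> a u v; rewrite /Bsigma -!/(transport _).
rewrite (pair_mx_lin p0 p'0 pp' (sgp _) (sgp u) (sgp v) (Pip' xi) (transport_linear a u v)).
rewrite (pair_mx_lin p0 p'0 pp' (Pip _) (Pip u) (Pip v) (sgp' xi) (gd_Pi_linear hD a u v)).
by ring.
Qed.

Lemma Bsigma_scalarr v : scalar (Bsigma O sigma D v).
Proof.
move=> a u w; rewrite /Bsigma -!/(transport _) ![pair_mx _ (transport v) _]pair_mxC.
rewrite ![pair_mx _ (gd_Pi D v) _]pair_mxC.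
rewrite (pair_mx_lin p0 p'0 pp' (sgp _) (sgp u) (sgp w) (Pip' v) (transport_linear a u w)).
rewrite (pair_mx_lin p0 p'0 pp' (Pip _) (Pip u) (Pip w) (sgp' v) (gd_Pi_linear hD a u w)).
by ring.
Qed.

Lemma Bsigma_diag v : Bsigma O sigma D v v = 0.
Proof. by rewrite /Bsigma [X in _ - _ * X]pair_mxC subrr. Qed.

Lemma load_scalar : scalar load.
Proof.
move=> a u v; rewrite /load ![pair_mx _ _ (gd_Pi D _)]pair_mxC.
apply: (pair_mx_lin two0 two0 two2) => //; last exact: gd_Pi_linear hD a u v.
apply: in_Lmx_row_mul => [|i|]; first by rewrite ler1n.
  exact: Winf_div_bounded hsigma.
by apply: (in_Lmx_wgrad _ hg); rewrite ler1n.
Qed.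

Let strain_p u : in_Lmx O p (fun x => gd_eps D u x + wsymgrad O g x).
Proof. by apply: in_LmxD (ltW hp) _ _ => //; exact: in_Lmx_wsymgrad (ltW hp) hg. Qed.

Let flux_p' u :
  in_Lmx O p' (fun x => Sflux p kappa (gd_eps D u x + wsymgrad O g x)).
Proof. exact: in_Lmx_Sflux. Qed.

Lemma flux_scalar u : scalar (flux_form u).
Proof.
move=> a v w; rewrite /flux_form ![pair_mx _ _ (gd_eps D _)]pair_mxC.
by apply: (pair_mx_lin p0 p'0 pp') => //; exact: gd_eps_linear hD a v w.
Qed.

(** The fixed strain of [g] cancels in the difference of the two arguments of [S],
    which leaves the strain of [u - v]. *)
Lemma flux_monotone u v : flux_form v (u - v) <= flux_form u (u - v).
Proof.
pose F w x := Sflux p kappa (gd_eps D w x + wsymgrad O g x).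
have I w : mu.-integrable setT (EFin \o (fun x => mxdot (F w x) (gd_eps D (u - v) x))).
  exact: pair_mx_integrable p'0 p0 p'p (flux_p' w) (epsp _).
have IB : mu.-integrable setT
    (EFin \o (fun x => mxdot (F u x) (gd_eps D (u - v) x) - mxdot (F v x) (gd_eps D (u - v) x))).
  exact: (integrableB measurableT (I u) (I v)).
rewrite -subr_ge0 /flux_form /pair_mx -(RintegralB measurableT (I u) (I v)).
apply: Rintegral_ae_ge0 => //.
apply: filterS (gd_eps_linear hD (-1) v u) => x.
rewrite !scaleN1r ![- _ + _]addrC => ->; rewrite -mxdotBl.
have := Sflux_monotone hp hkappa (gd_eps D u x + wsymgrad O g x)
  (gd_eps D v x + wsymgrad O g x).
by rewrite opprD addrACA subrr addr0.
Qed.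

Local Notation n := (form_norm mass).
Local Notation step := (midpoint_step E mass (Bsigma O sigma D) flux_form load tau).

(** The constant comes from the equivalence of norms in finite dimension and
    therefore depends on the discretisation. *)
Lemma CN_step_estimates : exists C : R, [/\ 0 <= C,
  forall v W w, E v -> E w -> step v W w -> n w <= n v + C * (tau + `|W|),
  forall v1 v2 W w1 w2, E v1 -> E v2 -> E w1 -> E w2 ->
    step v1 W w1 -> step v2 W w2 -> n (w1 - w2) <= n (v1 - v2) &
  forall v W1 W2 w1 w2, E v -> E w1 -> E w2 ->
    step v W1 w1 -> step v W2 w2 ->
    n (w1 - w2) <= C * (1 + n v + C * (tau + `|W2|)) * `|W1 - W2|].
Proof.
have [E0 El] := gd_E0_closed.
have [V VE] := vspace_of_closed E0 El.
have Vpos a : a \in V -> mass a a = 0 -> a = 0 by move=> /VE; exact: mass_pos.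
have [CB CB0 CBP] := bilinear_bounded mass_scalar massC mass_ge0 Vpos
  Bsigma_scalarr Bsigma_scalarl.
have [Cl Cl0 ClP] := scalar_bounded mass_scalar massC mass_ge0 Vpos load_scalar.
have [CF CF0 CFP] := scalar_bounded mass_scalar massC mass_ge0 Vpos (flux_scalar 0).
pose C := CB + Cl + CF; have C0 : 0 <= C by rewrite !addr_ge0.
have BC a b : E a -> E b -> `|Bsigma O sigma D a b| <= C * n a * n b.
  move=> /VE aV /VE bV; apply: le_trans (CBP _ _ aV bV) _.
  rewrite !ler_wpM2r ?form_norm_ge0//.
  by rewrite /C -addrA lerDl addr_ge0.
have lC a : E a -> `|load a| <= C * n a.
  move=> /VE aV; apply: le_trans (ClP _ aV) _.
  by rewrite ler_wpM2r ?form_norm_ge0// /C addrAC lerDr addr_ge0.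
have FC a : E a -> `|flux_form 0 a| <= C * n a.
  move=> /VE aV; apply: le_trans (CFP _ aV) _.
  by rewrite ler_wpM2r ?form_norm_ge0// /C lerDr addr_ge0.
exists C; split => //.
- move=> v W w; exact: (midpoint_step_bound mass_scalar massC mass_ge0
    Bsigma_diag flux_monotone E0 El htau C0 lC FC).
- move=> v1 v2 W w1 w2; exact: (midpoint_step_contract mass_scalar massC mass_ge0
    Bsigma_scalarl Bsigma_scalarr Bsigma_diag flux_monotone load_scalar
    E0 El htau).
- move=> v W1 W2 w1 w2; exact: (midpoint_step_update mass_scalar massC mass_ge0
    Bsigma_scalarl Bsigma_scalarr Bsigma_diag flux_monotone load_scalar
    E0 El htau C0 BC lC FC).
Qed.

Lemma CN_equationE v W w xi : CN_equation O p kappa tau g sigma D v W w xi <->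
  mass (w - v) xi + tau * flux_form (2^-1 *: (w + v)) xi =
  (Bsigma O sigma D (2^-1 *: (w + v)) xi + load xi) * W.
Proof.
suff -> : mass (w - v) xi = pair_mx O (gd_Pi D w \- gd_Pi D v) (gd_Pi D xi) by [].
rewrite (scalarB (mass_scalar _)) addrC -mulN1r; apply/esym.
apply: (pair_mx_lin two0 two0 two2) => //.
  move=> i j; rewrite (_ : (fun x => _) =
      fun x => -1 * gd_Pi D v x i j + gd_Pi D w x i j); last first.
    by apply/funext => x; rewrite !mxE mulN1r addrC.
  by apply: LfunZD; rewrite ?ler1n//; exact: Pi2.
by apply: aeW => x; rewrite scaleN1r addrC.
Qed.

Context {dOmega : measure_display} {Omega : measurableType dOmega}.
Variable P : probability Omega R.

(** The exceptional event of a solution may depend on the test function, and the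
    test functions used above depend on the outcome; one event for all of them
    is obtained from a basis. *)
Lemma CN_solution_step v dW w :
  CN_solution O p kappa tau g sigma D P v dW w ->
  {ae P, forall om, step (v om) (dW om) (w om)}.
Proof.
move=> [_ wP]; have [E0 El] := gd_E0_closed.
have [V VE] := vspace_of_closed E0 El.
have bE k : E (vbasis V)`_k.
  apply/VE; have [kV|kV] := ltnP k (\dim V).
    by apply: vbasis_mem; rewrite mem_nth ?size_tuple.
  by rewrite nth_default ?size_tuple// mem0v.
have := ae_foralln (fun k => wP _ (bE k)).
apply: filterS => om eqn xi /VE xiV.
pose u := 2^-1 *: (w om + v om).
pose T xi := (mass (w om - v om) xi + tau * flux_form u xi) -
  (Bsigma O sigma D u xi + load xi) * dW om.
have Ts : scalar T.
  move=> a y z; rewrite /T flux_scalar Bsigma_scalarr load_scalar.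
  rewrite (form_scalarr mass_scalar massC).
  by ring.
suff : T xi = 0 by move/eqP; rewrite subr_eq0 => /eqP.
rewrite (coord_vbasis xiV) (scalar_sum Ts) big1// => i _.
rewrite (scalarZ Ts); have /CN_equationE eqi := eqn i.
by rewrite /T /u eqi subrr mulr0.
Qed.

(** The squared norm is a quadratic polynomial in the coordinates. *)
Lemma measurable_velocity_norm (u : Omega -> X) : random_velocity O D u ->
  measurable_fun setT (fun om => Lnmx O 2 (gd_Pi D (u om))).
Proof.
move=> [_ mu_]; under eq_fun do rewrite Lnmx_mass.
apply: (measurableT_comp (continuous_measurable_fun (@sqrt_continuous R))).
pose e := vbasis {:X}.
rewrite (_ : (fun om => _) = fun om => \sum_i \sum_j
    coord e i (u om) * (coord e j (u om) * mass e`_i e`_j)).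
  apply: measurable_sum => i; apply: measurable_sum => j.
  by apply: measurable_funM => //; apply: measurable_funM.
apply/funext => om; rewrite {1 2}(coord_vbasis (memvf (u om))).
rewrite (scalar_sum (mass_scalar _)); apply: eq_bigr => i _.
rewrite (scalarZ (mass_scalar _)) (scalar_sum (form_scalarr mass_scalar massC _)).
rewrite mulr_sumr; apply: eq_bigr => j _.
by rewrite (scalarZ (form_scalarr mass_scalar massC _)).
Qed.

Lemma random_velocityB (u v : Omega -> X) : random_velocity O D u -> random_velocity O D v ->
  random_velocity O D (u \- v).
Proof.
move=> [Eu mu_] [Ev mv]; split=> [om|i].
  have [E0 El] := gd_E0_closed.
  by rewrite /= -scaleN1r addrC; exact: El.
under eq_fun do rewrite linearB/=.
exact: measurable_funB.
Qed.

End scheme_forms.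

(** * The solution operator *)

Theorem lemma31 (R : realType) (dOmega : measure_display)
  (Omega : measurableType dOmega) (P : probability Omega R)
  (d : nat) (O : polygonal_domain R d)
  (p kappa tau : R) (hp : 1 < p) (hkappa : 0 <= kappa) (htau : 0 < tau)
  (g sigma : 'rV[R]_d -> 'rV[R]_d)
  (hg : Winf_div O 2 g) (hsigma : Winf_div O 1 sigma)
  (X Y : vectType R) (D : grad_disc d X Y) (hD : is_grad_disc O p D)
  (Gamma : R) (hGamma : 1 <= Gamma) (hstable : gd_stable O p D Gamma)
  (SCN : (Omega -> X) -> (Omega -> R) -> (Omega -> X))
  (hSCN : CN_operator O p kappa tau g sigma D P SCN)
  (q : R) (hq : 0 < q) :
  let qbar : R := Num.max (4 / p) 1 * q in
  [/\ (forall v dW, LqE O D P q v -> dW \in Lfun P q%:E ->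
         LqE O D P q (SCN v dW)) /\
      (forall M : R, exists C : R, forall v dW,
         LqE O D P q v -> dW \in Lfun P q%:E ->
         (LqE_nm O D P q v <= M%:E)%E -> ('N[P]_(q%:E)[EFin \o dW] <= M%:E)%E ->
         (LqE_nm O D P q (SCN v dW) <= C%:E)%E),
      forall dW, dW \in Lfun P q%:E ->
        exists L : R, 0 <= L /\ forall v1 v2,
          LqE O D P q v1 -> LqE O D P q v2 ->
          (LqE_nm O D P q (SCN v1 dW \- SCN v2 dW)%R <=
             L%:E * LqE_nm O D P q (v1 \- v2)%R)%E &
      forall v, LqE O D P qbar v ->
        (forall dW, dW \in Lfun P qbar%:E -> LqE O D P q (SCN v dW)) /\
        forall dW0, dW0 \in Lfun P qbar%:E ->
        forall e : R, 0 < e -> exists delta : R, 0 < delta /\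
          forall dW, dW \in Lfun P qbar%:E ->
            ('N[P]_(qbar%:E)[EFin \o (dW \- dW0)%R] < delta%:E)%E ->
            (LqE_nm O D P q (SCN v dW \- SCN v dW0)%R < e%:E)%E].
Proof.
move=> qbar.
have qqbar : q <= qbar by rewrite /qbar ler_peMl ?(ltW hq)// le_max lexx orbT.
have [C [C0 bound contract update]] := CN_step_estimates hp hkappa htau hg hsigma hD.
pose n := form_norm (mass O D).
pose N (u : Omega -> X) om := Lnmx O 2 (gd_Pi D (u om)).
have NE u om : N u om = n (u om) by exact: Lnmx_mass.
have n0 a : 0 <= n a by exact: form_norm_ge0.
have N0 u om : 0 <= N u om by rewrite NE.
have mN u : random_velocity O D u -> measurable_fun setT (N u).
  by move=> ru; exact: (measurable_velocity_norm hD ru).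
have rvB (u v : Omega -> X) : random_velocity O D u -> random_velocity O D v ->
    random_velocity O D (u \- v).
  by move=> ru rv; exact: (random_velocityB hp hD ru rv).
have sol v dW : random_velocity O D v -> measurable_fun setT dW ->
    random_velocity O D (SCN v dW) /\
    {ae P, forall om, midpoint_step (gd_E0 O D) (mass O D) (Bsigma O sigma D)
      (flux_form O p kappa g D) (load O g sigma D) tau (v om) (dW om) (SCN v dW om)}.
  move=> rv mdW; have [s _] := hSCN v dW rv mdW.
  by split; [case: s|exact: (CN_solution_step hp hkappa hg hsigma hD s)].
(* one constant for the growth bound and for the local Lipschitz bound *)
pose K := 1 + C + C * tau.
have Ct0 : 0 <= C * tau by rewrite mulr_ge0// ltW.
have K0 : 0 <= K by rewrite !addr_ge0.
have affine (s a : R) : 0 <= s -> 0 <= a -> 1 + s + C * (tau + a) <= K * (1 + s + a).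
  move=> s0 a0; rewrite -subr_ge0.
  have -> : K * (1 + s + a) - (1 + s + C * (tau + a)) =
     a + C + C * s + C * tau * s + C * tau * a by rewrite /K; ring.
  by rewrite !addr_ge0 ?mulr_ge0 ?(ltW htau).
have growth v dW : random_velocity O D v -> measurable_fun setT dW ->
    {ae P, forall om, `|N (SCN v dW) om| <= K * (1 + `|N v om| + `|dW om|)}.
  move=> rv mdW; have [[Ew _]] := sol v dW rv mdW.
  apply: filterS => om st; rewrite !(ger0_norm (N0 _ _)) !NE.
  apply: le_trans (bound _ _ _ (rv.1 om) (Ew om) st) _.
  apply: le_trans (affine _ _ (n0 (v om)) (normr_ge0 (dW om))).
  by rewrite -addrA lerDr.
have into v dW : LqE O D P q v -> dW \in Lfun P q%:E -> LqE O D P q (SCN v dW).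
  move=> [rv vq] dWr; have mdW := Lfun_measurable dWr.
  have [rw _] := sol v dW rv mdW; split=> //.
  apply: (Lnorm_affine_lty hq K0 (mN _ rw) (mN _ rv) mdW (growth _ _ rv mdW)) => //.
  by move: dWr; rewrite inE => /andP[_]; rewrite inE.
have LqE_sub v : LqE O D P qbar v -> LqE O D P q v.
  by move=> [rv vr]; split=> //; exact: Lnorm_lty_le hq qqbar (mN _ rv) vr.
have Lfun_sub dW : dW \in Lfun P qbar%:E -> dW \in Lfun P q%:E.
  move=> dWr; have mdW := Lfun_measurable dWr.
  move: dWr; rewrite !inE => /andP[_]; rewrite inE => dWr.
  by apply/andP; split; rewrite inE//; exact: Lnorm_lty_le hq qqbar mdW dWr.
split.
- split=> [v dW|M]; first exact: into.
  have [C' C'P] := Lnorm_affine_bound P M hq K0.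
  exists C' => v dW [rv vq] dWq vM dWM; have mdW := Lfun_measurable dWq.
  have [rw _] := sol v dW rv mdW.
  exact: (C'P _ _ _ (mN _ rw) (mN _ rv) mdW (growth _ _ rv mdW)).
- move=> dW /Lfun_measurable mdW; exists 1; split=> // v1 v2 [rv1 _] [rv2 _].
  have [rw1 s1] := sol v1 dW rv1 mdW; have [rw2 s2] := sol v2 dW rv2 mdW.
  rewrite mul1e; have rv := rvB _ _ rv1 rv2.
  have rw := rvB _ _ rw1 rw2.
  rewrite /LqE_nm; apply: Lnorm_le hq (mN _ rw) (mN _ rv) _.
  apply: filterS2 s1 s2 => om e1 e2; rewrite !(ger0_norm (N0 _ _)) !NE.
  by apply: contract e1 e2; [exact: rv1.1|exact: rv2.1|exact: rw1.1|exact: rw2.1].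
- move=> v vqb; have [rv vq] := LqE_sub _ vqb; split=> [dW /Lfun_sub|].
    exact: into.
  move=> dW0 dW0qb e e0; have dW0q := Lfun_sub _ dW0qb.
  have mdW0 := Lfun_measurable dW0q.
  (* [Z] is the factor of [|dW - dW0|] in the local Lipschitz bound *)
  pose Z om := 1 + N v om + `|dW0 om|.
  have Z0 om : 0 <= Z om by rewrite !addr_ge0.
  have mZ : measurable_fun setT Z.
    apply: measurable_funD; last exact: measurableT_comp.
    by apply: measurable_funD => //; exact: mN.
  have Zq : ('N[P]_(q%:E)[EFin \o Z] < +oo)%E.
    apply: (Lnorm_affine_lty hq ler01 mZ (mN _ rv) mdW0 _ vq).
      by apply: aeW => om; rewrite mul1r (ger0_norm (Z0 om)) (ger0_norm (N0 _ _)).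
    by move: dW0q; rewrite inE => /andP[_]; rewrite inE.
  have [delta delta0 deltaP] := Lnorm_small (C := C * K + 2 * K) hq qqbar
    (addr_ge0 (mulr_ge0 C0 K0) (mulr_ge0 (ler0n R 2) K0)) e0 mZ Z0 Zq.
  exists delta; split=> // dW /Lfun_measurable mdW.
  have [rw s1] := sol v dW rv mdW; have [rw0 s0] := sol v dW0 rv mdW0.
  have rww := rvB _ _ rw rw0.
  apply: (deltaP _ _ (mN _ rww)); first exact: measurable_funB.
    apply: filterS2 s1 s0 => om e1 e2; rewrite (ger0_norm (N0 _ _)) NE.
    apply: le_trans (update _ _ _ _ _ (rv.1 om) (rw.1 om) (rw0.1 om) e1 e2) _.
    rewrite ler_wpM2r// mulrDl; apply: (@le_trans _ _ (C * K * Z om)).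
      by rewrite -mulrA ler_wpM2l// /Z NE affine.
    by rewrite lerDl !mulr_ge0.
  apply: filterS2 (growth _ _ rv mdW) (growth _ _ rv mdW0) => om.
  rewrite !(ger0_norm (N0 _ _)) !NE => g1 g0.
  have tri : n (SCN v dW om - SCN v dW0 om) <= n (SCN v dW om) + n (SCN v dW0 om).
    have nN : n (- SCN v dW0 om) = n (SCN v dW0 om).
      rewrite -scaleN1r /n (form_normZ (mass_scalar hD) (massC O D)).
      by rewrite normrN1 mul1r.
    by rewrite -nN; exact: (form_normD (mass_scalar hD) (massC O D) (mass_ge0 O D)).
  have dWE : `|dW om| <= `|dW0 om| + `|dW om - dW0 om|.
    by rewrite -{1}(subrK (dW0 om) (dW om)) addrC ler_normD.
  apply: le_trans tri _; apply: (@le_trans _ _ (2 * K * (Z om + `|dW om - dW0 om|))).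
    have : K * (1 + n (v om) + `|dW om|) <=
        K * (1 + n (v om) + (`|dW0 om| + `|dW om - dW0 om|)).
      by rewrite ler_wpM2l// lerD2l.
    have : 0 <= K * `|dW om - dW0 om| by rewrite mulr_ge0.
    by move: g1 g0; rewrite /Z NE; lra.
  by rewrite ler_wpM2r ?addr_ge0// lerDr mulr_ge0.
Qed.
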